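(* Let $u$ be a nonconstant inner function and let $S_u$ be the compressed shift on the model space $\mathcal{K}_u$. Then $m(S_u)=|u(0)|=m(S_u^* )$. Moreover, both $S_u$ and $S_u^*$ attain their minimum modulus.
   Context: $H^2$ is the Hardy space of the unit circle $\mathbb{T}$ (closed subspace of $L^2(\mathbb{T})$, normalized Lebesgue measure, of functions with vanishing negative Fourier coefficients), identified with analytic functions on the unit disc $\mathbb{D}$. An inner function is a bounded analytic function $u$ on $\mathbb{D}$ with $|u|=1$ a.e. on $\mathbb{T}$. The model space is $\mathcal{K}_u=H^2\ominus uH^2$, and $P_{\mathcal{K}_u}$ is the orthogonal projection onto it. $S$ is the unilateral shift $(Sf)(z)=zf(z)$ on $H^2$, and $S_u=P_{\mathcal{K}_u}S|_{\mathcal{K}_u}:\mathcal{K}_u\to\mathcal{K}_u$. For a bounded operator $T$ on a Hilbert space $K$, $m(T)=\inf\{\|Tx\|:x\in K,\ \|x\|=1\}$, and $T$ attains its minimum modulus if there is a unit vector $x_0\in K$ with $\|Tx_0\|=m(T)$. *)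

(* Defs.v *)
From HB Require Import structures.
From mathcomp Require Import all_boot all_order all_algebra.
From mathcomp Require Import all_classical all_reals all_analysis.
From mathcomp Require Export complex.

Set Implicit Arguments.
Unset Strict Implicit.
Unset Printing Implicit Defensive.

Import Order.TTheory GRing.Theory Num.Theory.
Import numFieldNormedType.Exports.

Local Open Scope classical_set_scope.
Local Open Scope ring_scope.
Local Open Scope complex_scope.

(* Functions on the circle T are represented by functions R[i] -> R[i] of which
   only the values e^(it) |-> f e^(it), 0 <= t <= 2 pi, are ever used.  Elements
   of L^2(T) are such functions up to a.e. equality: the inner product, the norm
   and all the subspaces below are invariant under changing a (measurable)
   representative on a null set. *)

Section circle.
Context {R : realType}.
Implicit Types f g : R[i] -> R[i].

Definition expi (t : R) : R[i] := cos t +i* sin t.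

Definition angles : set R := `[0, 2 * pi].

Definition ae_circle (P : R[i] -> Prop) : Prop :=
  {ae (@lebesgue_measure R), forall t, angles t -> P (expi t)}.

Definition circle_mean f : R[i] :=
  (2 * pi)^-1%:C *
  (\int[@lebesgue_measure R]_(t in angles) complex.Re (f (expi t))
   +i* \int[@lebesgue_measure R]_(t in angles) complex.Im (f (expi t))).

Definition circle_measurable f : Prop :=
  measurable_fun angles (fun t => complex.Re (f (expi t))) /\
  measurable_fun angles (fun t => complex.Im (f (expi t))).

Definition L2 : set (R[i] -> R[i]) :=
  [set f | circle_measurable f /\
    (\int[@lebesgue_measure R]_(t in angles)
       (Normc.normc (f (expi t)) ^+ 2)%:E < +oo)%E].

Definition dotL2 f g : R[i] := circle_mean (fun z => f z * (g z)^*).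

Definition normL2 f : R := Num.sqrt (complex.Re (dotL2 f f)).

Definition fourier_coef f (n : int) : R[i] := circle_mean (fun z => f z * z ^ (- n)).

Definition H2 : set (R[i] -> R[i]) :=
  [set f | L2 f /\ forall n : int, n < 0 -> fourier_coef f n = 0].

End circle.

Section inner_functions.
Context {R : realType}.
Implicit Types u : R[i] -> R[i].

Definition disc : set R[i] := [set z | Normc.normc z < 1].

(* R[i]^o carries the multiplication of R[i] as scaling, so that derivability
   in direction 1 is complex differentiability *)
Definition analytic_on_disc u : Prop :=
  forall z, disc z -> @derivable R[i] R[i]^o R[i]^o u z 1.

Definition radial_filter u (z : R[i]) : set_system R[i]^o :=
  (u (r%:C * z) : R[i]^o) @[r --> (1 : R)^'-].

Definition boundary u (z : R[i]) : R[i] := lim (radial_filter u z).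

(* By Fatou's theorem the radial limits of a bounded analytic function exist
   a.e.; existence is recorded since [lim] is a total operator. *)
Definition inner_function u : Prop :=
  [/\ analytic_on_disc u,
      exists M : R, forall z, disc z -> Normc.normc (u z) <= M &
      ae_circle (fun z => cvg (radial_filter u z) /\
                          Normc.normc (boundary u z) = 1)].

Definition nonconstant u : Prop :=
  ~ exists c : R[i], forall z, disc z -> u z = c.

End inner_functions.

Section model_space.
Context {R : realType}.
Local Notation fT := (R[i] -> R[i]).
Implicit Types (u f g : fT) (K : set fT) (T : fT -> fT).

Definition mulH2 u : set fT :=
  [set g | L2 g /\
    exists2 h, H2 h & ae_circle (fun z => g z = boundary u z * h z)].

Definition model_space u : set fT :=
  [set f | H2 f /\ forall g, mulH2 u g -> dotL2 f g = 0].

(* The orthogonal projection of f onto the closed subspace K and the adjoint of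
   an operator T on K are determined up to a.e. equality; [xget] selects a
   representative. *)
Definition orth_proj K f : fT :=
  xget (fun=> 0) [set g | K g /\ forall h, K h -> dotL2 (f \- g) h = 0].

Definition adjoint_on K T f : fT :=
  xget (fun=> 0) [set g | K g /\ forall h, K h -> dotL2 (T h) f = dotL2 h g].

Definition shift f : fT := fun z => z * f z.

Definition compressed_shift u f : fT := orth_proj (model_space u) (shift f).

Definition compressed_shift_adj u : fT -> fT :=
  adjoint_on (model_space u) (compressed_shift u).

Definition min_modulus K T : R :=
  inf [set normL2 (T f) | f in [set f | K f /\ normL2 f = 1]].

Definition attains_min_modulus K T : Prop :=
  exists f, [/\ K f, normL2 f = 1 & normL2 (T f) = min_modulus K T].

End model_space.

(* Main.v *)
(* Write [phi] for the boundary function of [u].  For [f] in the model space,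
   [S_u f = z f - <z f, phi> phi] and [S_u^* f = conj z (f - <f, 1>)], so that
   [|S_u f|^2 = |f|^2 - |<f, k1>|^2] and [|S_u^* f|^2 = |f|^2 - |<f, k2>|^2] for
   the elements [k1 = conj z (phi - u 0)] and [k2 = 1 - conj (u 0) phi] of the
   model space, both of squared norm [1 - |u 0|^2].  Both minima are therefore
   attained, at the normalizations of [k1] and [k2].

   These formulas use that [phi] multiplies [H^2] into itself, with mean [u 0].
   By Goursat's theorem on polar rectangles the mean of [u(w) w^(-n)] over
   [|w| = r] does not depend on [r]; letting [r] tend to [1] or to [0] gives the
   Fourier coefficients of [phi].  Products with [H^2] functions are reached by
   approximating the dilations [u(r z)] by their Fejer means.  Finally
   [|u 0| = 1] would force [k1 = 0], hence all the dilations, and [u], to be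
   constant. *)

Require Import Defs.
From mathcomp Require Import all_boot all_order all_algebra.
From mathcomp Require Import all_classical all_reals all_analysis.
From mathcomp Require Import complex.
From mathcomp Require Import measurable_realfun ring lra.
Import Order.TTheory GRing.Theory Num.Theory.
Import numFieldNormedType.Exports.
Local Open Scope classical_set_scope.
Local Open Scope complex_scope.
(* Opened last, so that [^*] is [Num.conj], as in [dotL2]. *)
Local Open Scope ring_scope.

(* [shift] alone would be the translation of MathComp-Analysis. *)
Local Notation shift := Defs.shift.

(** * Goursat's lemma on rectangles *)

Section rectangles.
Context {R : realType}.

(** Analyticity means bare complex differentiability here, with no continuity of the derivative to
    start from. The main consequence drawn from it is the independence of circle means of the
    radius: in polar coordinates this concerns a closed real form on a rectangle, to which bisection
    applies directly. The origin is excluded, because the form contains [1/r], and is recovered by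
    dominated convergence. The projection and the adjoint are selected by [xget]; the explicit
    formulas show that the sets selected from are nonempty, and the norms do not depend on the
    selection. The function [boundary u] is controlled only almost everywhere. It is traded for
    [radial_limit u], an upper limit along a sequence of radii, which is measurable and bounded on
    the whole circle. Fejer means serve twice: as uniformly bounded trigonometric polynomials that
    converge pointwise for continuous functions they give the products with [H2], and they recover a
    dilation from its Fourier coefficients. *)

Lemma nested_intervals (l r : nat -> R) :
  (forall n, l n <= l n.+1) -> (forall n, r n.+1 <= r n) ->
  (forall n, l n <= r n) -> exists p, forall n, l n <= p <= r n.
Proof.
move=> linc rdec lr.
have lmono : {homo l : m n / (m <= n)%N >-> m <= n}.
  by apply: homo_leq => // x y z; exact: le_trans.
have rmono : {homo r : m n / (m <= n)%N >-> n <= m}.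
  by apply: homo_leq => // x y z xy yz; exact: le_trans yz xy.
have ub n : ubound (range l) (r n).
  move=> _ [m _ <-]; have [mn|/ltnW nm] := leqP m n.
    exact: le_trans (lmono _ _ mn) (lr n).
  exact: le_trans (lr m) (rmono _ _ nm).
exists (sup (range l)) => n; apply/andP; split.
  by apply: ub_le_sup; [exists (r 0%N)|exists n].
by apply: ge_sup => //; exists (l 0%N), 0%N.
Qed.

Lemma exists_le_expr2 (x : R) : exists n, x <= 2 ^+ n.
Proof.
exists (Num.truncn x).+1; apply: le_trans (_ : (Num.truncn x).+1%:R <= _).
  exact/ltW/truncnS_gt.
by rewrite -natrX ler_nat ltnW// ltn_expl.
Qed.

(* Goursat's bisection: a rectangle of largest [J] among four halved ones
   keeps at least a quarter of [J]. *)
Lemma rect_additive_eq0 (J : R -> R -> R -> R -> R) (a b c d : R) :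
  a <= b -> c <= d ->
  (forall x y z s t, a <= x -> x <= y -> y <= z -> z <= b ->
     c <= s -> s <= t -> t <= d -> J x z s t = J x y s t + J y z s t) ->
  (forall x y s t v, a <= x -> x <= y -> y <= b ->
     c <= s -> s <= t -> t <= v -> v <= d -> J x y s v = J x y s t + J x y t v) ->
  (forall p q, a <= p <= b -> c <= q <= d -> forall e : R, 0 < e ->
     exists2 del : R, 0 < del & forall (h : R) x y s t, h <= del ->
       a <= x -> x <= p -> p <= y -> y <= b ->
       c <= s -> s <= q -> q <= t -> t <= d ->
       y - x <= h -> t - s <= h -> `|J x y s t| <= e * h ^+ 2) ->
  J a b c d = 0.
Proof.
move=> ab cd Jx Jy Jsmall.
pose w n := (b - a) / 2 ^+ n; pose v n := (d - c) / 2 ^+ n.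
have w0 n : 0 <= w n by rewrite divr_ge0 ?subr_ge0// exprn_ge0.
have v0 n : 0 <= v n by rewrite divr_ge0 ?subr_ge0// exprn_ge0.
have p2 n : (2 ^+ n : R) != 0 by rewrite expf_neq0.
have wS n : w n = w n.+1 + w n.+1.
  by rewrite /w exprS; have := p2 n; move: (2 ^+ n) => k k0; field.
have vS n : v n = v n.+1 + v n.+1.
  by rewrite /v exprS; have := p2 n; move: (2 ^+ n) => k k0; field.
(* A rectangle of generation [n] is recorded by its lower left corner alone, its sides being [w n]
   and [v n]. *)
pose A n (p : R * R) := `|J p.1 (p.1 + w n) p.2 (p.2 + v n)|.
pose inr n (p : R * R) := [/\ a <= p.1, p.1 + w n <= b, c <= p.2 & p.2 + v n <= d].
pose good n (p p' : R * R) := [/\ inr n.+1 p', p.1 <= p'.1,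
  p'.1 + w n.+1 <= p.1 + w n, p.2 <= p'.2 &
  p'.2 + v n.+1 <= p.2 + v n /\ A n p <= 4 * A n.+1 p'].
(* The proviso [inr] stands inside the existential so that [choice] yields a total function [F]; its
   values off [inr] are arbitrary. *)
have step : forall np : nat * (R * R), exists p', inr np.1 np.2 -> good np.1 np.2 p'.
  move=> [n p] /=; have [|ni] := pselect (inr n p); last by exists p.
  move=> [ap pb cp pd].
  have := wS n; have := vS n; have := w0 n.+1; have := v0 n.+1 => v1 w1 vn wn.
  pose q i j : R * R := (p.1 + i%:R * w n.+1, p.2 + j%:R * v n.+1).
  have Aq : A n p <= A n.+1 (q 0%N 0%N) + A n.+1 (q 1%N 0%N)
                  + (A n.+1 (q 0%N 1%N) + A n.+1 (q 1%N 1%N)).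
    rewrite /A /= !mul0r !addr0 !mul1r -!addrA -wn -vn.
    rewrite (Jx p.1 (p.1 + w n.+1) (p.1 + w n)); try lra.
    rewrite (Jy p.1 (p.1 + w n.+1) p.2 (p.2 + v n.+1) (p.2 + v n)); try lra.
    rewrite (Jy (p.1 + w n.+1) (p.1 + w n) p.2 (p.2 + v n.+1) (p.2 + v n)); try lra.
    set j1 := J _ _ _ _; set j2 := J _ _ _ _; set j3 := J _ _ _ _; set j4 := J _ _ _ _.
    have := ler_normD (j1 + j2) (j3 + j4); have := ler_normD j1 j2.
    have := ler_normD j3 j4; lra.
  suff [i [j [i1 j1 Aij]]] : exists i j, [/\ (i <= 1)%N, (j <= 1)%N &
      A n p <= 4 * A n.+1 (q i j)].
    have ik (k : nat) (x : R) : (k <= 1)%N -> 0 <= x -> 0 <= k%:R * x <= x.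
      by case: k => [|[|//]] _ x0; rewrite ?mul0r ?mul1r ?x0 ?lexx.
    have iw := ik i _ i1 w1; have jv := ik j _ j1 v1.
    exists (q i j) => _; split => /=; last split=> //;
      try split => /=; clear - ap pb cp pd wn vn iw jv; lra.
  have [h00|h00] := leP (A n p) (4 * A n.+1 (q 0%N 0%N)); first by exists 0%N, 0%N.
  have [h10|h10] := leP (A n p) (4 * A n.+1 (q 1%N 0%N)); first by exists 1%N, 0%N.
  have [h01|h01] := leP (A n p) (4 * A n.+1 (q 0%N 1%N)); first by exists 0%N, 1%N.
  exists 1%N, 1%N; split => //; lra.
have [F HF] := choice step.
pose P := fix P n := if n is m.+1 then F (m, P m) else (a, c).
have Pinr n : inr n (P n).
  elim: n => [|n IH]; first by split => //=; rewrite ?/w ?/v expr0; lra.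
  by have [] := HF (n, P n) IH.
have Pgood n : good n (P n) (P n.+1) := HF (n, P n) (Pinr n).
have [p hp] : exists p, forall n, (P n).1 <= p <= (P n).1 + w n.
  by apply: nested_intervals => n; have [? ? ? ? [? ?]] := Pgood n; rewrite ?lerDl.
have [q hq] : exists q, forall n, (P n).2 <= q <= (P n).2 + v n.
  by apply: nested_intervals => n; have [? ? ? ? [? ?]] := Pgood n; rewrite ?lerDl.
have A4 n : A 0%N (P 0%N) <= 4 ^+ n * A n (P n).
  elim: n => [|n IH]; first by rewrite expr0 mul1r.
  apply: le_trans IH _; rewrite exprSr -mulrA ler_wpM2l ?exprn_ge0//.
  by have [? ? ? ? [? ?]] := Pgood n.
(* [L] bounds both sides; the summand 1 keeps it positive for a degenerate rectangle. *)
pose L := b - a + (d - c) + 1.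
have L0 : 0 < L by rewrite /L; lra.
have pab : a <= p <= b.
  have := hp 0%N; rewrite /w /= expr0; lra.
have qcd : c <= q <= d.
  have := hq 0%N; rewrite /v /= expr0; lra.
have A0 : A 0%N (P 0%N) = `|J a b c d|.
  by rewrite /A /= /w /v expr0 !divr1 !(addrC _ (_ - _)) !subrK.
apply/eqP; rewrite -normr_le0 leNgt; apply/negP => J0.
(* With this tolerance [e], a rectangle of sides at most [L / 2^n] gives
   [4^n * e * (L / 2^n)^2 = |J| / 2], below the value that bisection preserves. *)
have e0 : 0 < `|J a b c d| / (2 * L ^+ 2) by rewrite divr_gt0// mulr_gt0// exprn_gt0.
have [del del0 Hdel] := Jsmall p q pab qcd _ e0.
have [n Hn] := exists_le_expr2 (L / del).
have k0 : 0 < (2 ^+ n : R) by rewrite exprn_gt0.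
have hdel : L / 2 ^+ n <= del by move: Hn; rewrite !ler_pdivrMr// mulrC.
have [ap pb cp pd] := Pinr n.
have /andP[p1 p2'] := hp n; have /andP[q1 q2'] := hq n.
have := Hdel (L / 2 ^+ n) (P n).1 ((P n).1 + w n) (P n).2 ((P n).2 + v n) hdel
  ap p1 p2' pb cp q1 q2' pd.
rewrite ![(_ + _) - _]addrAC !subrr !add0r /w /v => /(_ _ _).
rewrite !ler_pM2r ?invr_gt0// => /(_ _ _)/wrap[| |H].
- by rewrite /L; lra.
- by rewrite /L; lra.
have := A4 n; rewrite A0 leNgt => /negP; apply.
apply: le_lt_trans (_ : 4 ^+ n * (`|J a b c d| / (2 * L ^+ 2) * (L / 2 ^+ n) ^+ 2) < _).
  by rewrite ler_wpM2l// exprn_ge0.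
have -> : (4 : R) = 2 ^+ 2 by rewrite expr2 -natrM.
rewrite -exprM mulnC exprM; move: (2 ^+ n) k0 => k k0.
have -> : k ^+ 2 * (`|J a b c d| / (2 * L ^+ 2) * (L / k) ^+ 2) = `|J a b c d| / 2.
  by field; rewrite !gt_eqF.
lra.
Qed.

End rectangles.

(** * Green's formula on rectangles *)

Section closed_forms.
Context {R : realType}.
Notation mu := (@lebesgue_measure R).

Lemma Rintegral_itv_split (f : R -> R) (a x b : R) : a <= x -> x <= b ->
  mu.-integrable `[a, b] (EFin \o f) ->
  \int[mu]_(t in `[a, b]) f t =
  \int[mu]_(t in `[a, x]) f t + \int[mu]_(t in `[x, b]) f t.
Proof.
move=> ax xb fi; have fxb : mu.-integrable `]x, b] (EFin \o f).
  by apply: integrableS fi => //; apply: subset_itvr; rewrite bnd_simp.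
rewrite -(Rintegral_itv_obnd_cbnd fxb) -(Rintegral_itvB fi) ?bnd_simp//.
by rewrite addrC subrK.
Qed.

Lemma itv_integrableS (f : R -> R) (a b x y : R) : a <= x -> y <= b ->
  mu.-integrable `[a, b] (EFin \o f) -> mu.-integrable `[x, y] (EFin \o f).
Proof.
move=> ax yb; apply: integrableS => // t /=; rewrite !in_itv /= => /andP[xt ty].
by rewrite (le_trans ax xt) (le_trans ty yb).
Qed.

Lemma Rintegral_itv_cst (a b k : R) : a <= b -> 
  \int[mu]_(t in `[a, b]) k = k * (b - a).
Proof.
move=> ab; rewrite Rintegral_cst//; congr (_ * _).
have := lebesgue_measure_itv `[a, b]%R => /= ->; rewrite lte_fin; case: ltP => // ba.
by rewrite (@le_anti _ _ a b) ?ab ?subrr.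
Qed.

Lemma itv_cst_integrable (a b k : R) : mu.-integrable `[a, b] (EFin \o cst k).
Proof.
apply: continuous_compact_integrable; first exact: segment_compact.
by apply: continuous_subspaceT; exact: cst_continuous.
Qed.

Lemma itv_integrableB (a b : R) (f g : R -> R) :
  mu.-integrable `[a, b] (EFin \o f) -> mu.-integrable `[a, b] (EFin \o g) ->
  mu.-integrable `[a, b] (EFin \o (fun t => f t - g t)).
Proof. by move=> fi gi; exact: (integrableB _ fi gi). Qed.

Lemma Rintegral_itv_approx (f : R -> R) (a b k e : R) : a <= b ->
  mu.-integrable `[a, b] (EFin \o f) ->
  (forall t, a <= t <= b -> `|f t - k| <= e) ->
  `|\int[mu]_(t in `[a, b]) f t - k * (b - a)| <= e * (b - a).
Proof.
move=> ab fi fk.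
have fk' t : `[a, b]%classic t -> `|f t - k| <= e by rewrite /= in_itv/=; exact: fk.
rewrite ler_norml; apply/andP; split.
  rewrite -mulNr lerBrDr -mulrDl -Rintegral_itv_cst//; apply: le_Rintegral => //; first exact: itv_cst_integrable.
  by move=> t /fk'; rewrite ler_norml => /andP[]; lra.
rewrite lerBlDr -mulrDl -Rintegral_itv_cst//; apply: le_Rintegral => //; first exact: itv_cst_integrable.
by move=> t /fk'; rewrite ler_norml => /andP[]; lra.
Qed.

Lemma distr_le_between (s t v q h : R) : s <= q -> q <= t -> t - s <= h ->
  s <= v <= t -> `|v - q| <= h.
Proof. by rewrite ler_norml; lra. Qed.

(** The common slope [k] stands for [dQ/dx = dP/dt] at [(p, q)]. The hypothesis compares two points
    that are merely within [h] of [(p, q)], so it follows from differentiability at that single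
    point. On a rectangle of sides at most [h] around it, each integral differs from [k] times the
    area by at most [e / 2 * h^2], which is what the bisection asks for. *)
Lemma closed_form_rect (P Q : R -> R -> R) (a b c d : R) : a <= b -> c <= d ->
  (forall t, c <= t <= d -> mu.-integrable `[a, b] (EFin \o P^~ t)) ->
  (forall x, a <= x <= b -> mu.-integrable `[c, d] (EFin \o Q x)) ->
  (forall p q, a <= p <= b -> c <= q <= d -> exists k, forall e : R, 0 < e ->
     exists2 del : R, 0 < del & forall (h : R) x y s t, h <= del ->
       a <= x <= b -> a <= y <= b -> c <= s <= d -> c <= t <= d ->
       `|x - p| <= h -> `|y - p| <= h -> `|s - q| <= h -> `|t - q| <= h ->
       `|Q y s - Q x s - k * (y - x)| <= e * h /\
       `|P x t - P x s - k * (t - s)| <= e * h) ->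
  \int[mu]_(t in `[c, d]) (Q b t - Q a t) =
  \int[mu]_(x in `[a, b]) (P x d - P x c).
Proof.
move=> ab cd Pi Qi loc; apply/eqP; rewrite -subr_eq0; apply/eqP.
pose J x y s t := \int[mu]_(v in `[s, t]) (Q y v - Q x v) -
  \int[mu]_(v in `[x, y]) (P v t - P v s).
have Qi' x s t : a <= x <= b -> c <= s -> t <= d -> mu.-integrable `[s, t] (EFin \o Q x).
  by move=> xab cs td; exact: (itv_integrableS _ c d s t cs td (Qi x xab)).
have Pi' t x y : c <= t <= d -> a <= x -> y <= b -> mu.-integrable `[x, y] (EFin \o P^~ t).
  by move=> tcd ax yb; exact: (itv_integrableS _ a b x y ax yb (Pi t tcd)).
apply: (rect_additive_eq0 J) => //.
- move=> x y z s t ax xy yz zb cs st td; rewrite /J.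
  rewrite (Rintegral_itv_split _ x y z)//; last first.
    by apply: itv_integrableB; apply: Pi' => //; lra.
  rewrite opprD !RintegralB//; try (apply: Qi' => //; lra); try (apply: Pi' => //; lra).
  by ring.
- move=> x y s t v ax xy yb cs st tv vd; rewrite /J.
  rewrite (Rintegral_itv_split _ s t v)//; last first.
    by apply: itv_integrableB; apply: Qi' => //; lra.
  rewrite !RintegralB//; try (apply: Qi' => //; lra); try (apply: Pi' => //; lra).
  by ring.
move=> p q pab qcd e e0; have [k Hk] := loc p q pab qcd.
have e20 : 0 < e / 2 by lra.
have [del del0 Hdel] := Hk _ e20; exists del => // h x y s t hdel ax xp py yb cs sq qt td yxh tsh.
have sub (l r x0 y0 v : R) : l <= x0 -> y0 <= r -> x0 <= v <= y0 -> l <= v <= r.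
  by clear; lra.
have xy : x <= y := le_trans xp py; have st : s <= t := le_trans sq qt.
have xx : x <= x <= y by rewrite lexx. have yy : x <= y <= y by rewrite xy lexx.
have ss : s <= s <= t by rewrite lexx. have tt : s <= t <= t by rewrite st lexx.
have px v := distr_le_between _ _ v _ _ xp py yxh.
have qs v := distr_le_between _ _ v _ _ sq qt tsh.
have pab' v := sub _ _ _ _ v ax yb; have qcd' v := sub _ _ _ _ v cs td.
have Qxi := Qi' _ _ _ (pab' _ xx) cs td; have Qyi := Qi' _ _ _ (pab' _ yy) cs td.
have Psi := Pi' _ _ _ (qcd' _ ss) ax yb; have Pti := Pi' _ _ _ (qcd' _ tt) ax yb.
have h0 : 0 <= h by apply: le_trans yxh; rewrite subr_ge0.
have H1 : `|\int[mu]_(v in `[s, t]) (Q y v - Q x v) - k * (y - x) * (t - s)|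
    <= e / 2 * h * (t - s).
  apply: Rintegral_itv_approx => //; first exact: itv_integrableB.
  by move=> v vst; have [] := Hdel h x y v v hdel (pab' _ xx) (pab' _ yy)
    (qcd' _ vst) (qcd' _ vst) (px _ xx) (px _ yy) (qs _ vst) (qs _ vst).
have H2 : `|\int[mu]_(v in `[x, y]) (P v t - P v s) - k * (t - s) * (y - x)|
    <= e / 2 * h * (y - x).
  apply: Rintegral_itv_approx => //; first exact: itv_integrableB.
  by move=> v vxy; have [] := Hdel h v v s t hdel (pab' _ vxy) (pab' _ vxy)
    (qcd' _ ss) (qcd' _ tt) (px _ vxy) (px _ vxy) (qs _ ss) (qs _ tt).
rewrite /J; set i1 := \int[mu]_(v in _) _ in H1 *; set i2 := \int[mu]_(v in _) _ in H2 *.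
have eh0 : 0 <= e / 2 * h by rewrite mulr_ge0// ltW.
have b1 := ler_wpM2l eh0 tsh; have b2 := ler_wpM2l eh0 yxh.
move: (le_trans H1 b1) (le_trans H2 b2); rewrite (mulrAC k (t - s)) -(mulrA (e / 2)) -expr2 !ler_norml.
by clear; move: (k * _ * _) (h ^+ 2) => m h2; lra.
Qed.

End closed_forms.

(** * Moduli of complex numbers *)

Section complex_moduli.
Context {R : realType}.
Implicit Types z w : R[i].
Notation normc := (@Normc.normc R).

Lemma normc_ge0 z : 0 <= normc z.
Proof. by case: z => x y; exact: sqrtr_ge0. Qed.

Lemma normc_sqr z : normc z ^+ 2 = complex.Re z ^+ 2 + complex.Im z ^+ 2.
Proof. by case: z => x y /=; rewrite sqr_sqrtr// addr_ge0// sqr_ge0. Qed.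

Lemma ler_normcD z w : normc (z + w) <= normc z + normc w.
Proof. exact: le_normcD. Qed.

Lemma normc_opp z : normc (- z) = normc z.
Proof. by case: z => x y /=; rewrite !sqrrN. Qed.

Lemma ler_normcB z w : normc (z - w) <= normc z + normc w.
Proof. by rewrite -(normc_opp w) ler_normcD. Qed.

Lemma normcM z w : normc (z * w) = normc z * normc w.
Proof. exact: Normc.normcM. Qed.

Lemma normc_real (x : R) : normc x%:C = `|x|.
Proof. by rewrite /= expr0n addr0 sqrtr_sqr. Qed.

Lemma normcX z n : normc (z ^+ n) = normc z ^+ n.
Proof.
by elim: n => [|n IH]; rewrite ?expr0 ?Normc.normc1// !exprS normcM IH.
Qed.

Lemma conjE z : z^* = conjc z.
Proof. by []. Qed.

Lemma normc_conj z : normc z^* = normc z.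
Proof. by rewrite conjE; case: z => x y /=; rewrite sqrrN. Qed.

Lemma normr_Re_le z : `|complex.Re z| <= normc z.
Proof.
by rewrite -ler_sqr ?nnegrE ?normc_ge0// real_normK ?num_real// normc_sqr lerDl sqr_ge0.
Qed.

Lemma normr_Im_le z : `|complex.Im z| <= normc z.
Proof.
by rewrite -ler_sqr ?nnegrE ?normc_ge0// real_normK ?num_real// normc_sqr lerDr sqr_ge0.
Qed.

Lemma normc_le_ReIm z : normc z <= `|complex.Re z| + `|complex.Im z|.
Proof.
rewrite -ler_sqr ?nnegrE ?normc_ge0 ?addr_ge0// normc_sqr sqrrD !real_normK ?num_real//.
by rewrite addrAC lerDl mulrn_wge0 ?mulr_ge0.
Qed.

Lemma mulc_conj z : z * z^* = (normc z ^+ 2)%:C.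
Proof.
rewrite normc_sqr conjE; case: z => x y; apply/eqP.
by rewrite eq_complex /=; apply/andP; split; apply/eqP; ring.
Qed.

Lemma ReD z w : complex.Re (z + w) = complex.Re z + complex.Re w.
Proof. by case: z w => [? ?] [? ?]. Qed.

Lemma ImD z w : complex.Im (z + w) = complex.Im z + complex.Im w.
Proof. by case: z w => [? ?] [? ?]. Qed.

Lemma ReN z : complex.Re (- z) = - complex.Re z.
Proof. by case: z. Qed.

Lemma ImN z : complex.Im (- z) = - complex.Im z.
Proof. by case: z. Qed.

Lemma ReJ z : complex.Re z^* = complex.Re z.
Proof. by rewrite conjE; case: z. Qed.

Lemma ImJ z : complex.Im z^* = - complex.Im z.
Proof. by rewrite conjE; case: z. Qed.

Lemma complex_ext z w : complex.Re z = complex.Re w ->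
  complex.Im z = complex.Im w -> z = w.
Proof. by case: z w => [? ?] [? ?] /= -> ->. Qed.

Lemma normc_expi (t : R) : normc (expi t) = 1.
Proof. by rewrite /= cos2Dsin2 sqrtr1. Qed.

Lemma normc_real_expi (r t : R) : 0 <= r -> normc (r%:C * expi t) = r.
Proof. by move=> r0; rewrite normcM normc_expi mulr1 normc_real ger0_norm. Qed.

End complex_moduli.

(** * Increments of [expi] *)

Section expi_estimates.
Context {R : realType}.

(** Mean value theorem against a comparison slope: [k = 0] gives Lipschitz bounds, and [k] the
    derivative at [q] gives second-order bounds. *)
Lemma derive_lipschitz (f df : R -> R) (q k h e s t : R) :
  (forall x : R, is_derive x (1 : R) f (df x)) ->
  (forall x, `|x - q| <= h -> `|df x - k| <= e) ->
  `|s - q| <= h -> `|t - q| <= h -> `|f t - f s - k * (t - s)| <= e * `|t - s|.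
Proof.
move=> fd dfk; wlog st : s t / s <= t => [H sq tq|].
  have [st|/ltW ts] := leP s t; first exact: H.
  rewrite (_ : _ - _ = - (f s - f t - k * (s - t))); first by rewrite normrN (distrC t) H.
  ring.
move=> sq tq; have [x xst ->] : exists2 c, c \in `[s, t]%R & f t - f s = df c * (t - s).
  apply: MVT_segment => //; apply: continuous_subspaceT => x.
  exact/differentiable_continuous/derivable1_diffP/ex_derive.
rewrite -mulrBl normrM ler_wpM2r// dfk//; move: sq tq xst.
by rewrite in_itv/= !ler_norml => *; lra.
Qed.

Lemma normr_cos_sub (s t : R) : `|cos t - cos s| <= `|t - s|.
Proof.
have := @derive_lipschitz cos (fun x => - sin x) s 0 `|t - s| 1 s t.
rewrite mul0r subr0 mul1r subrr normr0; apply => // x _.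
by rewrite subr0 normrN ler_norml sin_geN1 sin_le1.
Qed.

Lemma normr_sin_sub (s t : R) : `|sin t - sin s| <= `|t - s|.
Proof.
have := @derive_lipschitz sin cos s 0 `|t - s| 1 s t.
rewrite mul0r subr0 mul1r subrr normr0; apply => // x _.
by rewrite subr0 ler_norml cos_geN1 cos_le1.
Qed.

Lemma normc_expi_sub (s t : R) : Normc.normc (expi t - expi s) <= 2 * `|t - s|.
Proof.
apply: le_trans (normc_le_ReIm _) _.
by have := normr_cos_sub s t; have := normr_sin_sub s t; rewrite /=; lra.
Qed.

(** Each coordinate contributes at most [h * |t - s| <= 2 * h^2], since its derivative stays within
    [h] of the value at [q]. *)
Lemma normc_expi_sub_linear (q h s t : R) : `|s - q| <= h -> `|t - q| <= h ->
  Normc.normc (expi t - expi s - 'i * expi q * (t - s)%:C) <= 4 * h ^+ 2.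
Proof.
move=> sq tq; apply: le_trans (normc_le_ReIm _) _ => /=.
rewrite !mul0r !mulr0 !mul1r !subr0 !add0r.
have := @derive_lipschitz cos (fun x => - sin x) q (- sin q) h h s t.
have := @derive_lipschitz sin cos q (cos q) h h s t.
have ts : `|t - s| <= 2 * h by move: sq tq; rewrite !ler_norml; lra.
have h0 : 0 <= h by apply: le_trans sq; exact: normr_ge0.
have hts : h * `|t - s| <= 2 * h ^+ 2.
  by rewrite expr2 mulrCA ler_wpM2l.
move=> /(_ _ _ sq tq)/wrap[x xq|S]; first exact: le_trans (normr_cos_sub _ _) xq.
move=> /(_ _ _ sq tq)/wrap[x xq|C].
  by rewrite -opprD normrN; exact: le_trans (normr_sin_sub _ _) xq.
move: S C; rewrite mulNr opprK; lra.
Qed.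

End expi_estimates.

(** * Complex differentiability and means over concentric circles *)

Section complex_differentiability.
Context {R : realType}.
Implicit Types (G : R[i] -> R[i]) (w z D : R[i]).
Notation normc := (@Normc.normc R).
Notation mu := (@lebesgue_measure R).

(** Stated with real moduli, because the norm on [R[i]] takes its values in [R[i]]. *)
Definition ccontinuous_at G w := forall e : R, 0 < e ->
  exists2 d : R, 0 < d & forall z, normc (z - w) < d -> normc (G z - G w) <= e.

Definition cderivable_at G w := exists D, forall e : R, 0 < e ->
  exists2 d : R, 0 < d & forall z, normc (z - w) < d ->
    normc (G z - G w - D * (z - w)) <= e * normc (z - w).

Lemma cderivable_continuous G w : cderivable_at G w -> ccontinuous_at G w.
Proof.
move=> [D HD] e e0; have [d d0 Hd] := HD _ ltr01.
have D0 := normc_ge0 D; have k0 : 0 < 1 + normc D by lra.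
exists (Num.min d (e / (1 + normc D))) => [|z]; first by rewrite lt_min d0 divr_gt0.
rewrite lt_min => /andP[/Hd H1 H2]; rewrite -(subrK (D * (z - w)) (G z - G w)).
apply: le_trans (ler_normcD _ _) _; rewrite normcM.
move: H2; rewrite ltr_pdivlMr// mulrDr mulr1 mulrC; move: H1; rewrite mul1r; lra.
Qed.

Lemma norm_normc z : `|z| = (normc z)%:C.
Proof. by case: z. Qed.

(** The increments along direction [1] are complex scalars, so the derivative in this one direction
    controls all increments [z - w]. *)
Lemma derivable_cderivable_at G w :
  @derivable R[i] R[i]^o R[i]^o G w 1 -> cderivable_at G w.
Proof.
move=> /cvg_ex[D /cvgrPdist_le /= HD]; exists D => e e0.
have e0' : 0 < e%:C :> R[i] by rewrite ltcR.
(* The radius of a ball in [R[i]] is a complex number; being positive, it is real. *)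
have /nbhs_ballP[[d1 d2]] := HD _ e0'.
rewrite /= ltcE /= => /andP[/eqP d20 d10]; rewrite d20 => Hd.
exists d1 => // z zw; have [->|zw0] := eqVneq z w.
  by rewrite !subrr mulr0 subr0 Normc.normc0 mulr0.
have z0 : z - w != 0 by rewrite subr_eq0.
have := Hd (z - w); rewrite /ball /= sub0r normrN norm_normc ltcR => /(_ zw z0).
rewrite [_%:A]mulr1 subrK norm_normc lecR => H.
have -> : G z - G w - D * (z - w) = - ((D - (z - w)^-1 * (G z - G w)) * (z - w)).
  by rewrite mulrBl mulrAC mulVf// mul1r opprB.
by rewrite normc_opp normcM ler_wpM2r// normc_ge0.
Qed.

Lemma real_continuous_at (f : R -> R) (x : R) :
  (forall e : R, 0 < e -> exists2 d : R, 0 < d &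
    forall y, `|y - x| < d -> `|f y - f x| <= e) -> {for x, continuous f}.
Proof.
move=> H; apply/cvgrPdist_le => e e0; have [d d0 Hd] := H e e0.
apply/nbhs_ballP; exists d => // y; rewrite /ball/= distrC => yx.
by rewrite distrC; exact: Hd.
Qed.

Lemma ccontinuous_Re_path G (gam : R -> R[i]) (x K : R) :
  (forall y, normc (gam y - gam x) <= K * `|y - x|) ->
  ccontinuous_at G (gam x) -> {for x, continuous (fun t => complex.Re (G (gam t)))}.
Proof.
move=> gamK Gc; apply: real_continuous_at => e e0; have [d d0 Hd] := Gc e e0.
exists (d / (1 + `|K|)) => [|y]; first by rewrite divr_gt0// ltr_pwDl.
rewrite ltr_pdivlMr ?ltr_pwDl// mulrDr mulr1 => yx.
rewrite -ReN -ReD; apply: le_trans (normr_Re_le _) _; apply: Hd.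
apply: le_lt_trans (gamK y) _; apply: le_lt_trans yx.
rewrite mulrC; have := ler_norm K; have := normr_ge0 (y - x) => y0 K0.
by apply: le_trans (ler_wpM2l y0 K0) _; rewrite lerDr.
Qed.

Lemma ccontinuousZ G w D : ccontinuous_at G w -> ccontinuous_at (fun z => D * G z) w.
Proof.
move=> Gc e e0; have D0 := normc_ge0 D; have k0 : 0 < 1 + normc D by lra.
have [d d0 Hd] := Gc (e / (1 + normc D)) (divr_gt0 e0 k0).
exists d => // z /Hd; rewrite -mulrBr normcM ler_pdivlMr//.
by have := normc_ge0 (G z - G w); lra.
Qed.

Lemma cderivableZ G w D : cderivable_at G w -> cderivable_at (fun z => D * G z) w.
Proof.
move=> [E HE]; exists (D * E) => e e0; have D0 := normc_ge0 D.
have k0 : 0 < 1 + normc D by lra.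
have [d d0 Hd] := HE (e / (1 + normc D)) (divr_gt0 e0 k0).
exists d => // z /Hd; rewrite mulrAC ler_pdivlMr//.
rewrite (_ : D * G z - _ - _ = D * (G z - G w - E * (z - w))); last by ring.
by rewrite normcM; have := normc_ge0 (G z - G w - E * (z - w)); lra.
Qed.

Lemma angles_le0 : (0 : R) <= 2 * pi.
Proof. by rewrite mulr_ge0// pi_ge0. Qed.

Lemma expi0 : expi (0 : R) = 1.
Proof. by rewrite /expi cos0 sin0. Qed.

Lemma expi2pi : expi (2 * pi : R) = 1.
Proof. by rewrite /expi mulr_natl cos2pi sin2pi. Qed.

(* With [w = r e^(it)], the form [G(w) dw / (i w) = G (dt + dr / (i r))] is closed. *)
Lemma Re_circle_integral_const G (r1 r2 : R) : 0 < r1 -> r1 <= r2 -> r2 < 1 ->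
  (forall w, 0 < normc w < 1 -> cderivable_at G w) ->
  \int[mu]_(t in angles) complex.Re (G (r1%:C * expi t)) =
  \int[mu]_(t in angles) complex.Re (G (r2%:C * expi t)).
Proof.
move=> r10 r12 r21 Gd.
have r_disc x t : r1 <= x <= r2 -> 0 < normc (x%:C * expi t) < 1.
  by move=> x12; rewrite normc_real_expi; lra.
pose Q (x t : R) := complex.Re (G (x%:C * expi t)).
pose P (x t : R) := complex.Re (- 'i * G (x%:C * expi t)) / x.
have Qc x : r1 <= x <= r2 -> continuous (Q x).
  move=> x12 t; apply: (ccontinuous_Re_path _ (fun t => x%:C * expi t) _ (2 * x)).
    move=> y; cbv beta; rewrite -mulrBr normcM normc_real ger0_norm; last lra.
    by rewrite (mulrC 2) -mulrA ler_wpM2l ?normc_expi_sub//; lra.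
  exact/cderivable_continuous/Gd/r_disc.
have Qi x : r1 <= x <= r2 -> mu.-integrable angles (EFin \o Q x).
  move=> x12; apply: continuous_compact_integrable; first exact: segment_compact.
  exact/continuous_subspaceT/Qc.
have H : \int[mu]_(t in angles) (Q r2 t - Q r1 t) =
    \int[mu]_(x in `[r1, r2]) (P x (2 * pi) - P x 0).
  apply: closed_form_rect => //; first exact: angles_le0.
    move=> t t2pi; apply: continuous_compact_integrable; first exact: segment_compact.
    apply: continuous_in_subspaceT => x; rewrite inE /= in_itv /= => x12.
    apply: cvgM; last by apply: cvgV => //; rewrite gt_eqF//; lra.
    apply: (ccontinuous_Re_path (fun z => - 'i * G z) (fun x => x%:C * expi t) _ 1).
      by move=> y; cbv beta; rewrite -mulrBl normcM normc_expi mulr1 mul1r -rmorphB normc_real.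
    exact/ccontinuousZ/cderivable_continuous/Gd/r_disc.
  move=> p q p12 _; have [D HD] := Gd _ (r_disc p q p12).
  (* [D * expi q] is the radial derivative of [G] and also the angular derivative of [G / (i r)],
     where the factor [i r] from differentiating [r e^(it)] cancels. *)
  exists (complex.Re (D * expi q)) => e e0; have D0 := normc_ge0 D.
  (* Points whose polar coordinates are within [h] of [(p, q)] are within [3 * h] in the plane, so
     each [Err] costs [e * r1 / 4 * h]. The second bound on [h] below makes the second-order terms
     of the polar coordinates cost [e * r1 / 2 * h]. The total [e * r1 * h] absorbs the division by
     the radius in [P]. *)
  have [d d0 Hd] := HD (e * r1 / 12) ltac:(apply: divr_gt0 => //; exact: mulr_gt0).
  have k0 : 0 < 8 * (normc D + 1) by lra.
  exists (Num.min (d / 4) (e * r1 / (8 * (normc D + 1)))).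
    by rewrite lt_min !divr_gt0// mulr_gt0.
  move=> h x y s t; rewrite le_min ler_pdivlMr// => /andP[hd].
  rewrite ler_pdivlMr// => hD x12 y12 _ _ xp yp sq tq.
  have h0 : 0 <= h by apply: le_trans xp; exact: normr_ge0.
  pose Err z := G z - G (p%:C * expi q) - D * (z - p%:C * expi q).
  have ErrP x' s' : r1 <= x' <= r2 -> `|x' - p| <= h -> `|s' - q| <= h ->
      normc (Err (x'%:C * expi s')) <= e * r1 / 4 * h.
    move=> x'12 x'p s'q.
    have zw : normc (x'%:C * expi s' - p%:C * expi q) <= 3 * h.
      rewrite (_ : _ - _ = (x' - p)%:C * expi s' + p%:C * (expi s' - expi q)); last first.
        by rewrite rmorphB; ring.
      apply: le_trans (ler_normcD _ _) _; rewrite !normcM normc_expi !normc_real mulr1.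
      have := normc_expi_sub q s'; rewrite (ger0_norm (_ : 0 <= p)); last lra.
      have := normc_ge0 (expi s' - expi q); nra.
    have [d3|] := ltP (3 * h) d; last lra.
    apply: le_trans (Hd _ (le_lt_trans zw d3)) _.
    have -> : e * r1 / 4 * h = e * r1 / 12 * (3 * h) by field.
    by rewrite ler_wpM2l// divr_ge0// mulr_ge0//; lra.
  have Gsub x' s' y' t' : G (y'%:C * expi t') - G (x'%:C * expi s') =
      Err (y'%:C * expi t') - Err (x'%:C * expi s') +
      D * (y'%:C * expi t' - x'%:C * expi s') by rewrite /Err; ring.
  have hh : normc D * (4 * h ^+ 2) <= e * r1 / 2 * h.
    by rewrite expr2; nra.
  split.
    have -> : Q y s - Q x s - complex.Re (D * expi q) * (y - x) =
        complex.Re (Err (y%:C * expi s) - Err (x%:C * expi s) +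
                    D * ((y - x)%:C * (expi s - expi q))).
      rewrite /Q -ReN -ReD Gsub.
      rewrite (_ : complex.Re (D * expi q) * (y - x) =
        complex.Re (D * expi q * (y - x)%:C)); last by case: (D * _) => a b /=; ring.
      rewrite -ReN -ReD; congr complex.Re; rewrite rmorphB; ring.
    apply: le_trans (normr_Re_le _) _; apply: le_trans (ler_normcD _ _) _.
    have E1 := ErrP y s y12 yp sq; have E2 := ErrP x s x12 xp sq.
    have := ler_normcB (Err (y%:C * expi s)) (Err (x%:C * expi s)).
    have : normc (D * ((y - x)%:C * (expi s - expi q))) <= normc D * (4 * h ^+ 2).
      rewrite !normcM normc_real ler_wpM2l// expr2.
      have := normc_expi_sub q s; have yx : `|y - x| <= 2 * h.
        by move: xp yp; rewrite !ler_norml; lra.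
      have := normr_ge0 (y - x); have := normc_ge0 (expi s - expi q); nra.
    have : e * r1 * h <= e * h by rewrite -mulrA ler_wpM2l//; [lra|nra].
    lra.
  have x0 : 0 < x by lra.
  have -> : P x t - P x s - complex.Re (D * expi q) * (t - s) =
      complex.Re (- 'i * (Err (x%:C * expi t) - Err (x%:C * expi s) +
         D * (x%:C * (expi t - expi s - 'i * expi q * (t - s)%:C)))) / x.
    rewrite /P -mulrBl -ReN -ReD -mulrBr Gsub -[LHS](mulfK (lt0r_neq0 x0)).
    congr (_ / _); rewrite mulrBl divfK ?lt0r_neq0//.
    rewrite (_ : complex.Re (D * expi q) * (t - s) * x =
        complex.Re (D * expi q * (x * (t - s))%:C)); last first.
      by case: (D * _) => a b /=; ring.
    rewrite -ReN -ReD; congr complex.Re; rewrite rmorphM.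
    have ii : 'i * 'i = -1 :> R[i] by rewrite -expr2 sqr_i.
    apply/eqP; rewrite -subr_eq0.
    (* The identity holds modulo ['i * 'i = -1], so the difference is exhibited as a multiple of
       [1 + 'i * 'i]. *)
    rewrite (_ : _ - _ = - (1 + 'i * 'i) * (D * expi q * (x%:C * (t - s)%:C))).
      by rewrite ii subrr oppr0 mul0r.
    by ring.
  rewrite normrM normfV (ger0_norm (ltW x0)) ler_pdivrMr//.
  apply: le_trans (normr_Re_le _) _; rewrite normcM normc_opp.
  rewrite (_ : normc 'i = 1) ?mul1r; last by rewrite /= expr0n expr1n add0r sqrtr1.
  apply: le_trans (ler_normcD _ _) _.
  have E1 := ErrP x t x12 xp tq; have E2 := ErrP x s x12 xp sq.
  have := ler_normcB (Err (x%:C * expi t)) (Err (x%:C * expi s)).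
  have : normc (D * (x%:C * (expi t - expi s - 'i * expi q * (t - s)%:C)))
      <= normc D * (4 * h ^+ 2).
    rewrite !normcM normc_real ler_wpM2l// (ger0_norm (ltW x0)).
    have := normc_expi_sub_linear q h s t sq tq.
    have := normc_ge0 (expi t - expi s - 'i * expi q * (t - s)%:C); nra.
  have : e * r1 * h <= e * h * x by rewrite mulrAC ler_wpM2l//; [nra|lra].
  lra.
move: H; rewrite RintegralB//; try (apply: Qi; lra); last exact: measurable_itv.
(* The two radial sides cancel, because [expi] agrees at [0] and [2 * pi]. *)
rewrite [X in _ = X -> _](_ : _ = 0); last first.
  rewrite (_ : (fun _ => _) = cst 0) ?Rintegral_itv_cst ?mul0r//.
  by apply/funext => x; rewrite /P expi0 expi2pi subrr.
by move/eqP; rewrite subr_eq0 => /eqP ->.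
Qed.

Lemma circle_mean_dilation_const G (r1 r2 : R) : 0 < r1 -> r1 <= r2 -> r2 < 1 ->
  (forall w, 0 < normc w < 1 -> cderivable_at G w) ->
  circle_mean (fun z => G (r1%:C * z)) = circle_mean (fun z => G (r2%:C * z)).
Proof.
move=> r10 r12 r21 Gd; rewrite /circle_mean (Re_circle_integral_const G r1 r2)//.
congr (_ * (_ +i* _)).
have ImRe z : complex.Im z = complex.Re (- 'i * z).
  by case: z => a b /=; ring.
under eq_Rintegral do rewrite ImRe.
under [RHS]eq_Rintegral do rewrite ImRe.
apply: (Re_circle_integral_const (fun z => - 'i * G z)) => // w /Gd.
exact: cderivableZ.
Qed.

End complex_differentiability.

(** * Integration over the circle *)

Section circle_integration.
Context {R : realType}.
Implicit Types F G : R[i] -> R[i].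
Notation mu := (@lebesgue_measure R).
Notation normc := (@Normc.normc R).

Definition circle_integrable F :=
  mu.-integrable angles (EFin \o (fun t => complex.Re (F (expi t)))) /\
  mu.-integrable angles (EFin \o (fun t => complex.Im (F (expi t)))).

Lemma measurable_angles : measurable (angles : set (measurableTypeR R)).
Proof. exact: measurable_itv. Qed.

Hint Resolve measurable_angles : core.

Lemma circle_integrable_measurable F : circle_integrable F -> circle_measurable F.
Proof.
by move=> [/integrableP[/measurable_EFinP mr _] /integrableP[/measurable_EFinP mi _]].
Qed.

Lemma circle_measurable_cst (c : R[i]) : circle_measurable (fun=> c).
Proof. by split; exact: measurable_cst. Qed.

Lemma circle_measurable_id : circle_measurable (@id R[i]).
Proof.
split => /=.
  apply: measurable_funTS; apply: continuous_measurable_fun; exact: continuous_cos.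
apply: measurable_funTS; apply: continuous_measurable_fun; exact: continuous_sin.
Qed.

Lemma circle_measurableD F G : circle_measurable F -> circle_measurable G ->
  circle_measurable (fun z => F z + G z).
Proof.
move=> [Fr Fi] [Gr Gi]; split.
  by under eq_fun do rewrite ReD; exact: measurable_funD.
by under eq_fun do rewrite ImD; exact: measurable_funD.
Qed.

Lemma ReM (z w : R[i]) : complex.Re (z * w) =
  complex.Re z * complex.Re w - complex.Im z * complex.Im w.
Proof. by case: z w => [? ?] [? ?]. Qed.

Lemma ImM (z w : R[i]) : complex.Im (z * w) =
  complex.Re z * complex.Im w + complex.Im z * complex.Re w.
Proof. by case: z w => [? ?] [? ?]. Qed.

Lemma circle_measurableM F G : circle_measurable F -> circle_measurable G ->
  circle_measurable (fun z => F z * G z).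
Proof.
move=> [Fr Fi] [Gr Gi]; split.
  under eq_fun do rewrite ReM.
  by apply: measurable_funB; exact: measurable_funM.
under eq_fun do rewrite ImM.
by apply: measurable_funD; exact: measurable_funM.
Qed.

Lemma circle_measurable_conj F : circle_measurable F ->
  circle_measurable (fun z => (F z)^*).
Proof.
move=> [Fr Fi]; split.
  by rewrite (_ : (fun t => _) = fun t => complex.Re (F (expi t)))//; apply/funext => t; rewrite ReJ.
rewrite (_ : (fun t => _) = \- (fun t => complex.Im (F (expi t)))).
  exact: measurable_funN.
by apply/funext => t; rewrite ImJ.
Qed.

Lemma circle_mean_eq F G : (forall t, F (expi t) = G (expi t)) ->
  circle_mean F = circle_mean G.
Proof.
move=> FG; rewrite /circle_mean; congr (_ * (_ +i* _));
  by apply: eq_Rintegral => t _; rewrite FG.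
Qed.

Lemma circle_measurable_eq F G : (forall t, F (expi t) = G (expi t)) ->
  circle_measurable F -> circle_measurable G.
Proof.
move=> FG; rewrite /circle_measurable.
rewrite (_ : (fun t => complex.Re (G _)) = (fun t => complex.Re (F (expi t)))); last first.
  by apply/funext => t; rewrite FG.
rewrite (_ : (fun t => complex.Im (G _)) = (fun t => complex.Im (F (expi t))))//.
by apply/funext => t; rewrite FG.
Qed.

Lemma circle_integrable_eq F G : (forall t, F (expi t) = G (expi t)) ->
  circle_integrable F -> circle_integrable G.
Proof.
move=> FG [Fr Fi]; split.
  by apply: eq_integrable Fr => // t _; rewrite /= FG.
by apply: eq_integrable Fi => // t _; rewrite /= FG.
Qed.

Lemma circle_integrable_le F (g : R -> R) : circle_measurable F ->
  mu.-integrable angles (EFin \o g) ->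
  (forall t, normc (F (expi t)) <= g t) -> circle_integrable F.
Proof.
move=> [Fr Fi] gi Fg; split.
  apply: (le_integrable measurable_angles _ _ gi).
    exact/measurable_EFinP.
  move=> t _; rewrite /= lee_fin; apply: le_trans (le_trans (Fg t) (ler_norm _)).
  exact: normr_Re_le.
apply: (le_integrable measurable_angles _ _ gi).
  exact/measurable_EFinP.
move=> t _; rewrite /= lee_fin; apply: le_trans (le_trans (Fg t) (ler_norm _)).
exact: normr_Im_le.
Qed.

Lemma circle_integrable_bound F : circle_integrable F -> 
  exists2 g : R -> R, mu.-integrable angles (EFin \o g) &
    forall t, normc (F (expi t)) <= g t.
Proof.
move=> [Fr Fi].
exists (fun t => `|complex.Re (F (expi t))| + `|complex.Im (F (expi t))|).
  have := integrableD measurable_angles (integrable_abse Fr) (integrable_abse Fi).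
  by apply: eq_integrable => // t _; rewrite /= EFinD.
by move=> t; exact: normc_le_ReIm.
Qed.

Lemma integrable_cst_angles (k : R) : mu.-integrable angles (EFin \o cst k).
Proof. exact: itv_cst_integrable. Qed.

Lemma circle_integrable_bounded F (M : R) : circle_measurable F ->
  (forall t, normc (F (expi t)) <= M) -> circle_integrable F.
Proof. by move=> Fm; exact/circle_integrable_le/integrable_cst_angles. Qed.

Lemma circle_integrable_cst (c : R[i]) : circle_integrable (fun=> c).
Proof. by apply: circle_integrable_bounded (circle_measurable_cst c) _. Qed.

Lemma circle_integrableM_bounded F G (M : R) : circle_integrable F ->
  circle_measurable G -> (forall t, normc (G (expi t)) <= M) ->
  circle_integrable (fun z => F z * G z).
Proof.
move=> Fi Gm GM; have [g gi Fg] := circle_integrable_bound _ Fi.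
apply: (circle_integrable_le _ (fun t => M * g t)).
- by apply: circle_measurableM => //; exact: circle_integrable_measurable.
- by have := integrableZl measurable_angles M gi; apply: eq_integrable.
- by move=> t; rewrite normcM mulrC ler_pM ?normc_ge0.
Qed.

Lemma circle_integrableD F G : circle_integrable F -> circle_integrable G ->
  circle_integrable (fun z => F z + G z).
Proof.
move=> [Fr Fi] [Gr Gi]; split.
  have := integrableD measurable_angles Fr Gr; apply: eq_integrable => // t _.
  by rewrite /= ReD EFinD.
have := integrableD measurable_angles Fi Gi; apply: eq_integrable => // t _.
by rewrite /= ImD EFinD.
Qed.

Lemma circle_integrableZ (c : R[i]) F : circle_integrable F ->
  circle_integrable (fun z => c * F z).
Proof.
move=> Fi; have := @circle_integrableM_bounded F (fun=> c) (normc c) Fi.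
move=> /(_ (circle_measurable_cst c) (fun=> lexx _)).
by apply: circle_integrable_eq => t; rewrite mulrC.
Qed.

Lemma circle_integrable_sum (I : Type) (s : seq I) (F : I -> R[i] -> R[i]) :
  (forall i, circle_integrable (F i)) ->
  circle_integrable (fun z => \sum_(i <- s) F i z).
Proof.
move=> Fi; elim: s => [|i s IH].
  apply: circle_integrable_eq (circle_integrable_cst 0) => t.
  by rewrite big_nil.
apply: circle_integrable_eq (circle_integrableD _ _ (Fi i) IH) => t.
by rewrite big_cons.
Qed.

Lemma circle_meanD F G : circle_integrable F -> circle_integrable G ->
  circle_mean (fun z => F z + G z) = circle_mean F + circle_mean G.
Proof.
move=> [Fr Fi] [Gr Gi]; rewrite /circle_mean -mulrDr; congr (_ * _).
under eq_Rintegral do rewrite ReD.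
under [X in _ +i* X]eq_Rintegral do rewrite ImD.
by rewrite !RintegralD.
Qed.

Lemma circle_meanZ (c : R[i]) F : circle_integrable F ->
  circle_mean (fun z => c * F z) = c * circle_mean F.
Proof.
move=> [Fr Fi]; rewrite /circle_mean mulrCA; congr (_ * _).
under eq_Rintegral do rewrite ReM.
under [X in _ +i* X]eq_Rintegral do rewrite ImM.
have Z (k : R) (f : R -> R) : mu.-integrable angles (EFin \o f) ->
    mu.-integrable angles (EFin \o (fun t => k * f t)).
  by move=> fi; have := integrableZl measurable_angles k fi; apply: eq_integrable.
rewrite RintegralB ?RintegralD//; try exact: Z.
by rewrite !RintegralZl//; case: c.
Qed.

Lemma Re_scale (k : R) (z : R[i]) : complex.Re (k%:C * z) = k * complex.Re z.
Proof. by case: z => x y /=; ring. Qed.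

Lemma conjc_scale (k : R) (z : R[i]) : (k%:C * z)^* = k%:C * z^*.
Proof. by rewrite !conjE; case: z => x y; apply: complex_ext => /=; ring. Qed.

Lemma circle_mean_conj F : circle_integrable F ->
  circle_mean (fun z => (F z)^*) = (circle_mean F)^*.
Proof.
move=> [Fr Fi]; rewrite /circle_mean conjc_scale; congr (_ * _).
apply: complex_ext => /=; first by apply: eq_Rintegral => t _; rewrite ReJ.
rewrite -mulN1r -RintegralZl//; apply: eq_Rintegral => t _.
by rewrite ImJ mulN1r.
Qed.

Lemma circle_mean_sum (I : Type) (s : seq I) (F : I -> R[i] -> R[i]) :
  (forall i, circle_integrable (F i)) ->
  circle_mean (fun z => \sum_(i <- s) F i z) = \sum_(i <- s) circle_mean (F i).
Proof.
move=> Fi; elim: s => [|i s IH].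
  rewrite big_nil (circle_mean_eq _ (fun z => 0 * 0)).
    by rewrite circle_meanZ ?mul0r//; exact: circle_integrable_cst.
  by move=> t; rewrite big_nil mul0r.
rewrite big_cons -IH -circle_meanD//; last exact: circle_integrable_sum.
by apply: circle_mean_eq => t; rewrite big_cons.
Qed.

Lemma circle_mean_cst (c : R[i]) : circle_mean (fun=> c) = c.
Proof.
rewrite /circle_mean !Rintegral_itv_cst ?angles_le0// subr0.
have -> : (complex.Re c * (2 * pi) +i* (complex.Im c * (2 * pi))) = (2 * pi)%:C * c.
  by case: c => a b; apply: complex_ext => /=; ring.
by rewrite mulrA -rmorphM mulVf ?mul1r// mulf_neq0// gt_eqF// pi_gt0.
Qed.

Lemma ae_mono (P Q : R -> Prop) : (forall t, P t -> Q t) ->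
  {ae mu, forall t, P t} -> {ae mu, forall t, Q t}.
Proof. by move=> PQ; apply: (@filterS _ _ (ae_filter_ringOfSetsType mu)). Qed.

Lemma ae_and (P Q : R -> Prop) :
  {ae mu, forall t, P t} -> {ae mu, forall t, Q t} -> {ae mu, forall t, P t /\ Q t}.
Proof. exact: (@filterI _ _ (ae_filter_ringOfSetsType mu)). Qed.

Lemma ae_all (P : R -> Prop) : (forall t, P t) -> {ae mu, forall t, P t}.
Proof.
move=> PT; apply: (ae_mono (fun=> True)) => //.
exact: (@filterT _ _ (ae_filter_ringOfSetsType mu)).
Qed.

Lemma Rintegral_angles_ae (f g : R -> R) : measurable_fun angles f ->
  measurable_fun angles g -> {ae mu, forall t, angles t -> f t = g t} ->
  \int[mu]_(t in angles) f t = \int[mu]_(t in angles) g t.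
Proof.
move=> fm gm fg; rewrite /Rintegral; congr fine.
have H := ae_eq_integral (mu := mu) (EFin \o g) (EFin \o f) measurable_angles.
apply: H.
- exact/measurable_EFinP.
- exact/measurable_EFinP.
- by apply: ae_mono fg => t fg /fg /= ->.
Qed.

Lemma circle_mean_ae F G : circle_measurable F -> circle_measurable G ->
  ae_circle (fun z => F z = G z) -> circle_mean F = circle_mean G.
Proof.
move=> [Fr Fi] [Gr Gi] FG; rewrite /circle_mean.
by congr (_ * (_ +i* _)); apply: Rintegral_angles_ae => //;
  apply: ae_mono FG => t FG /FG ->.
Qed.

(** Dominated convergence in the only form used: the integrals are constant along the sequence, so
    the conclusion is an equation and not a limit. *)
Lemma Rintegral_limit (f_ : nat -> R -> R) (f g : R -> R) (k : R) :
  (forall n, measurable_fun angles (f_ n)) -> measurable_fun angles f ->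
  mu.-integrable angles (EFin \o g) -> (forall n t, `|f_ n t| <= g t) ->
  {ae mu, forall t, angles t -> f_ ^~ t @ \oo --> f t} ->
  (forall n, \int[mu]_(t in angles) f_ n t = k) ->
  \int[mu]_(t in angles) f t = k.
Proof.
move=> f_m fm gi f_g f_f fk.
have f_i n : mu.-integrable angles (EFin \o f_ n).
  apply: (le_integrable measurable_angles _ _ gi).
    exact: (proj2 (measurable_EFinP _ _) (f_m n)).
  by move=> t _; rewrite /= lee_fin (le_trans (f_g n t))// ler_norm.
have f_f' : {ae mu, forall t, angles t -> (EFin \o f_ n) t @[n --> \oo] --> (EFin \o f) t}.
  by apply: ae_mono f_f => t + Dt => /(_ Dt) ft; apply: cvg_EFin ft; exact: nearW.
have f_g' : {ae mu, forall t n, angles t -> (`|(EFin \o f_ n) t| <= (EFin \o g) t)%E}.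
  by apply: ae_all => t n _; rewrite /= lee_fin.
have [fi _] := @dominated_convergence _ _ _ mu _ measurable_angles
  (fun n => EFin \o f_ n) _ _ (fun n => proj2 (measurable_EFinP _ _) (f_m n))
  (proj2 (measurable_EFinP _ _) fm) f_f' gi f_g'.
rewrite (_ : [sequence _]_n = cst k%:E); last first.
  by apply/funext => n; rewrite /= -(fk n) fineK//; apply: integrable_fin_num (f_i n).
move/(cvg_unique _ (cvg_cst _))/esym => fk'.
by rewrite /Rintegral; have := fk' => /= ->.
Qed.

Lemma circle_mean_limit (F_ : nat -> R[i] -> R[i]) F (g : R -> R) (c : R[i]) :
  (forall n, circle_measurable (F_ n)) -> circle_measurable F ->
  mu.-integrable angles (EFin \o g) ->
  (forall n t, normc (F_ n (expi t)) <= g t) ->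
  ae_circle (fun z => forall e : R, 0 < e ->
    exists N, forall n, (N <= n)%N -> normc (F_ n z - F z) <= e) ->
  (forall n, circle_mean (F_ n) = c) -> circle_mean F = c.
Proof.
move=> F_m Fm gi F_g F_F Fc; rewrite -(Fc 0%N).
have k0 : (2 * pi)^-1%:C != 0 :> R[i].
  by rewrite -(rmorph0 (real_complex R)) (inj_eq (@complexI R)) invr_eq0 mulf_neq0// gt_eqF ?pi_gt0.
have F0 n : circle_mean (F_ n) = circle_mean (F_ 0%N) by rewrite !Fc.
have {}F0 n := mulfI k0 (F0 n).
rewrite /circle_mean; congr (_ * (_ +i* _)).
  apply: (Rintegral_limit (fun n t => complex.Re (F_ n (expi t))) _ g) => //.
  - by move=> n; have [] := F_m n.
  - by have [] := Fm.
  - by move=> n t; apply: le_trans (F_g n t); exact: normr_Re_le.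
  - apply: ae_mono F_F => t F_F /F_F {}F_F; apply/cvgrPdist_le => e /F_F[N HN].
    near=> n; rewrite distrC -ReN -ReD; apply: le_trans (normr_Re_le _) _.
    by apply: HN; near: n; exact: nbhs_infty_ge.
  - by move=> n; have [] := F0 n.
apply: (Rintegral_limit (fun n t => complex.Im (F_ n (expi t))) _ g) => //.
- by move=> n; have [] := F_m n.
- by have [] := Fm.
- by move=> n t; apply: le_trans (F_g n t); exact: normr_Im_le.
- apply: ae_mono F_F => t F_F /F_F {}F_F; apply/cvgrPdist_le => e /F_F[N HN].
  near=> n; rewrite distrC -ImN -ImD; apply: le_trans (normr_Im_le _) _.
  by apply: HN; near: n; exact: nbhs_infty_ge.
- by move=> n; have [] := F0 n.
Unshelve. all: by end_near. Qed.

(** The factor 2 comes from estimating real and imaginary parts separately; it is harmless because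
    only boundedness and smallness of means are deduced. *)
Lemma normc_circle_mean_le F G : circle_integrable F -> circle_integrable G ->
  (forall t, normc (F (expi t)) <= complex.Re (G (expi t))) ->
  normc (circle_mean F) <= 2 * complex.Re (circle_mean G).
Proof.
move=> [Fr Fi] [Gr _] FG; have k0 : 0 <= (2 * pi)^-1 :> R by rewrite invr_ge0 angles_le0.
rewrite /circle_mean normcM normc_real ger0_norm// Re_scale mulrCA ler_wpM2l//.
have le (f : R -> R) : mu.-integrable angles (EFin \o f) ->
    (forall t, `|f t| <= complex.Re (G (expi t))) ->
    `|\int[mu]_(t in angles) f t| <= \int[mu]_(t in angles) complex.Re (G (expi t)).
  move=> fi fG; apply: le_trans (le_normr_Rintegral _ _) _ => //.
  by apply: le_Rintegral => //; exact: integrable_norm.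
apply: le_trans (normc_le_ReIm _) _; rewrite mulr_natl mulr2n lerD// le// => t.
  exact: le_trans (normr_Re_le _) (FG t).
exact: le_trans (normr_Im_le _) (FG t).
Qed.

End circle_integration.

(** * The inner product of [L2] *)

Section L2_inner_product.
Context {R : realType}.
Implicit Types f g h : R[i] -> R[i].
Notation mu := (@lebesgue_measure R).
Notation normc := (@Normc.normc R).

Local Hint Resolve measurable_angles : core.

Lemma measurable_normc_sqr f : circle_measurable f ->
  measurable_fun angles (EFin \o (fun t => normc (f (expi t)) ^+ 2)).
Proof.
move=> [fr fi]; apply: (proj2 (measurable_EFinP _ _)).
under eq_fun do rewrite normc_sqr.
by apply: measurable_funD; exact: measurable_funX.
Qed.

Lemma L2P f : L2 f <-> circle_measurable f /\
  mu.-integrable angles (EFin \o (fun t => normc (f (expi t)) ^+ 2)).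
Proof.
pose q t : R := normc (f (expi t)) ^+ 2.
have E : (\int[mu]_(t in angles) (q t)%:E)%E = (\int[mu]_(t in angles) `|(EFin \o q) t|)%E.
  by apply: eq_integral => t _; rewrite /= ger0_norm// sqr_ge0.
split=> [[fm]|[fm /integrableP[_]]].
  rewrite [X in (X < _)%E]E => fi; split => //; apply/integrableP; split => //.
  exact: measurable_normc_sqr.
by rewrite -[X in (X < _)%E]E.
Qed.

Lemma L2_dot_integrable f g : L2 f -> L2 g -> circle_integrable (fun z => f z * (g z)^*).
Proof.
move=> /L2P[fm fi] /L2P[gm gi].
apply: (circle_integrable_le _ (fun t => normc (f (expi t)) ^+ 2 + normc (g (expi t)) ^+ 2)).
- exact: (circle_measurableM _ _ fm (circle_measurable_conj _ gm)).
- have := integrableD measurable_angles fi gi; apply: eq_integrable => // t _.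
- move=> t; rewrite normcM normc_conj.
  have := normc_ge0 (f (expi t)); have := normc_ge0 (g (expi t)); nra.
Qed.

Lemma L2_le f (g : R -> R) : circle_measurable f ->
  mu.-integrable angles (EFin \o g) ->
  (forall t, normc (f (expi t)) ^+ 2 <= g t) -> L2 f.
Proof.
move=> fm gi fg; apply/L2P; split => //.
apply: (le_integrable measurable_angles _ _ gi); first exact: measurable_normc_sqr.
move=> t _; rewrite /= lee_fin ger0_norm ?sqr_ge0//.
exact: le_trans (fg t) (ler_norm _).
Qed.

Lemma L2D f g : L2 f -> L2 g -> L2 (fun z => f z + g z).
Proof.
move=> /L2P[fm fi] /L2P[gm gi].
apply: (L2_le _ (fun t => 2 * (normc (f (expi t)) ^+ 2 + normc (g (expi t)) ^+ 2))).
- exact: circle_measurableD.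
- have := integrableZl measurable_angles 2 (integrableD measurable_angles fi gi).
  apply: eq_integrable => // t _.
- move=> t; have := ler_normcD (f (expi t)) (g (expi t)).
  have := normc_ge0 (f (expi t) + g (expi t)).
  move: (normc (f _)) (normc (g _)) (normc (_ + _)) => a b c c0 cab.
  apply: le_trans (_ : (a + b) ^+ 2 <= _); first by rewrite lerXn2r ?nnegrE//; lra.
  have := sqr_ge0 (a - b); lra.
Qed.

Lemma L2_mul_bounded (psi : R[i] -> R[i]) f (M : R) : circle_measurable psi ->
  (forall t, normc (psi (expi t)) <= M) -> L2 f -> L2 (fun z => psi z * f z).
Proof.
move=> pm pM /L2P[fm fi].
apply: (L2_le _ (fun t => M ^+ 2 * normc (f (expi t)) ^+ 2)).
- exact: circle_measurableM.
- have := integrableZl measurable_angles (M ^+ 2) fi; apply: eq_integrable => // t _.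
- move=> t; rewrite normcM exprMn ler_wpM2r ?sqr_ge0// lerXn2r ?nnegrE ?normc_ge0//.
  exact: le_trans (normc_ge0 _) (pM t).
Qed.

Lemma L2_bounded f (M : R) : circle_measurable f ->
  (forall t, normc (f (expi t)) <= M) -> L2 f.
Proof.
move=> fm fM; apply: (L2_le _ (cst (M ^+ 2))) => //; first exact: integrable_cst_angles.
move=> t; rewrite lerXn2r ?nnegrE ?normc_ge0//.
exact: le_trans (normc_ge0 _) (fM t).
Qed.

Lemma L2_cst (c : R[i]) : L2 (fun=> c).
Proof. exact: (L2_bounded _ (normc c) (circle_measurable_cst c) (fun=> lexx _)). Qed.

Lemma L2Z (c : R[i]) f : L2 f -> L2 (fun z => c * f z).
Proof. exact: (L2_mul_bounded _ f (normc c) (circle_measurable_cst c) (fun=> lexx _)). Qed.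

Lemma L2B f g : L2 f -> L2 g -> L2 (fun z => f z - g z).
Proof.
move=> fL gL; have := L2D f _ fL (L2Z (-1) _ gL).
by congr L2; apply/funext => z; rewrite mulN1r.
Qed.

Lemma dotL2_eq f f' g g' : (forall t, f (expi t) = f' (expi t)) ->
  (forall t, g (expi t) = g' (expi t)) -> dotL2 f g = dotL2 f' g'.
Proof. by move=> ff gg; apply: circle_mean_eq => t; rewrite ff gg. Qed.

Lemma dotL2_ae f f' g : L2 f -> L2 f' -> L2 g ->
  ae_circle (fun z => f z = f' z) -> dotL2 f g = dotL2 f' g.
Proof.
move=> fL f'L gL ff; apply: circle_mean_ae.
- by have [] := circle_integrable_measurable _ (L2_dot_integrable f g fL gL).
- by have [] := circle_integrable_measurable _ (L2_dot_integrable f' g f'L gL).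
- by apply: ae_mono ff => t + Dt => /(_ Dt) ->.
Qed.

Lemma dotL2Dl f g h : L2 f -> L2 g -> L2 h ->
  dotL2 (fun z => f z + g z) h = dotL2 f h + dotL2 g h.
Proof.
move=> fL gL hL; rewrite -circle_meanD; try exact: L2_dot_integrable.
by apply: circle_mean_eq => t; rewrite mulrDl.
Qed.

Lemma dotL2Zl (c : R[i]) f g : L2 f -> L2 g ->
  dotL2 (fun z => c * f z) g = c * dotL2 f g.
Proof.
move=> fL gL; rewrite -circle_meanZ; last exact: L2_dot_integrable.
by apply: circle_mean_eq => t; rewrite mulrA.
Qed.

Lemma dotL2C f g : L2 f -> L2 g -> dotL2 g f = (dotL2 f g)^*.
Proof.
move=> fL gL; rewrite -circle_mean_conj; last exact: L2_dot_integrable.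
by apply: circle_mean_eq => t; rewrite rmorphM /= conjCK mulrC.
Qed.

Lemma dotL2Bl f g h : L2 f -> L2 g -> L2 h ->
  dotL2 (fun z => f z - g z) h = dotL2 f h - dotL2 g h.
Proof.
move=> fL gL hL; rewrite -[in RHS]mulN1r -dotL2Zl// -dotL2Dl//; last exact: L2Z.
by apply: dotL2_eq => t //; rewrite mulN1r.
Qed.

Lemma dotL2Dr f g h : L2 f -> L2 g -> L2 h ->
  dotL2 h (fun z => f z + g z) = dotL2 h f + dotL2 h g.
Proof.
move=> fL gL hL; rewrite (dotL2C _ h)//; last exact: L2D.
by rewrite dotL2Dl// (dotL2C f h)// (dotL2C g h)// rmorphD.
Qed.

Lemma dotL2Br f g h : L2 f -> L2 g -> L2 h ->
  dotL2 h (fun z => f z - g z) = dotL2 h f - dotL2 h g.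
Proof.
move=> fL gL hL; rewrite (dotL2C _ h)//; last exact: L2B.
by rewrite dotL2Bl// (dotL2C f h)// (dotL2C g h)// rmorphB.
Qed.

Lemma dotL2Zr (c : R[i]) f g : L2 f -> L2 g ->
  dotL2 g (fun z => c * f z) = c^* * dotL2 g f.
Proof.
move=> fL gL; rewrite (dotL2C _ g)//; last exact: L2Z.
by rewrite dotL2Zl// (dotL2C f g)// rmorphM.
Qed.

Lemma real_complexD (x y : R) : (x + y)%:C = x%:C + y%:C.
Proof. exact: rmorphD. Qed.

Lemma real_complexB (x y : R) : (x - y)%:C = x%:C - y%:C.
Proof. exact: rmorphB. Qed.

Lemma real_complexM (x y : R) : (x * y)%:C = x%:C * y%:C.
Proof. exact: rmorphM. Qed.

Lemma real_complex2 : (2 : R)%:C = 2.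
Proof. exact: (rmorph_nat (real_complex R)). Qed.

Lemma Re_dotL2_ge0 f : 0 <= complex.Re (dotL2 f f).
Proof.
rewrite /dotL2 /circle_mean Re_scale mulr_ge0 ?invr_ge0 ?angles_le0//=.
by apply: Rintegral_ge0 => t _; rewrite mulc_conj /= sqr_ge0.
Qed.

Lemma dotL2_self f : L2 f -> dotL2 f f = (normL2 f ^+ 2)%:C.
Proof.
move=> fL; rewrite /normL2 sqr_sqrtr ?Re_dotL2_ge0//.
apply: complex_ext => //; change (complex.Im (dotL2 f f) = 0).
have := congr1 (@complex.Im R) (dotL2C f f fL fL); rewrite ImJ.
by move: (complex.Im _) => x; lra.
Qed.

Lemma normL2_ge0 f : 0 <= normL2 f.
Proof. exact: sqrtr_ge0. Qed.

(** Pythagoras for the component along a unit vector. With [g] the constant 1 or the boundary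
    function it yields the norm formulas for the adjoint and for the compressed shift, and the norm
    of [kernel0]. *)
Lemma normL2_sub_proj f g : L2 f -> L2 g -> normL2 g = 1 ->
  normL2 (fun z => f z - dotL2 f g * g z) ^+ 2 = normL2 f ^+ 2 - normc (dotL2 f g) ^+ 2.
Proof.
move=> fL gL g1; set c := dotL2 f g.
have cgL := L2Z c g gL; have fcgL := L2B f _ fL cgL.
apply: (@complexI R); rewrite -dotL2_self//.
rewrite dotL2Bl// !dotL2Br// !dotL2Zl// !dotL2Zr// (dotL2C f g)// !dotL2_self// -/c g1.
by rewrite real_complexB -mulc_conj expr1n; ring.
Qed.

Lemma normc_dotL2_le f g : L2 f -> L2 g ->
  normc (dotL2 f g) ^+ 2 <= normL2 f ^+ 2 * normL2 g ^+ 2.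
Proof.
move=> fL gL; set c := dotL2 f g; set A := normc c ^+ 2.
(* This expands [|f - s c g|^2] for real [s]; the factor [c] absorbs the phase of the inner
   product. *)
have H (s : R) : 0 <= normL2 f ^+ 2 - 2 * s * A + s ^+ 2 * A * normL2 g ^+ 2.
  have cgL := L2Z (s%:C * c) g gL; have fcgL := L2B f _ fL cgL.
  rewrite (_ : _ + _ = normL2 (fun z => f z - s%:C * c * g z) ^+ 2) ?sqr_ge0//.
  apply: (@complexI R); rewrite -dotL2_self//.
  rewrite dotL2Bl// !dotL2Br// !dotL2Zl// !dotL2Zr// (dotL2C f g)// !dotL2_self// -/c.
  have cc : c * c^* = A%:C := mulc_conj c.
  move: A cc => A cc; rewrite [in RHS](_ : (s%:C * c)^* = s%:C * c^*); last exact: conjc_scale.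
  rewrite real_complexD real_complexB !real_complexM -!cc real_complex2.
  ring.
have A0 : 0 <= A by exact: sqr_ge0.
(* If [g] has norm 0, an affine function of [s] is left, and the next choice of [s] gives it the
   value [-1] when [A > 0]. Otherwise [s = 1 / |g|^2] minimizes the quadratic. *)
have [g0|g0] := eqVneq (normL2 g ^+ 2) 0.
  rewrite g0 mulr0 leNgt; apply/negP => A0'.
  have := H ((normL2 f ^+ 2 + 1) / (2 * A)); rewrite g0 mulr0 addr0.
  rewrite (_ : 2 * _ * _ = normL2 f ^+ 2 + 1); last by field; rewrite gt_eqF.
  lra.
have g1 : 0 < normL2 g ^+ 2 by rewrite lt_def g0 sqr_ge0.
have := H (normL2 g ^+ 2)^-1; move: (normL2 g ^+ 2) g0 g1 => G g0 g1.
rewrite (_ : _ + _ = normL2 f ^+ 2 - A / G); last by field.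
by rewrite subr_ge0 ler_pdivrMr.
Qed.

End L2_inner_product.

(** * Fejer means *)

Section fejer_means.
Context {R : realType}.
Implicit Types (f g : R[i] -> R[i]) (x z w zeta : R[i]).
Notation mu := (@lebesgue_measure R).
Notation normc := (@Normc.normc R).

Local Hint Resolve measurable_angles : core.

Lemma normc1_neq0 x : normc x = 1 -> x != 0.
Proof.
move=> x1; apply/eqP => x0; move: x1; rewrite x0 Normc.normc0 => /esym/eqP.
by rewrite oner_eq0.
Qed.

Lemma expi_neq0 (t : R) : expi t != 0.
Proof. exact/normc1_neq0/normc_expi. Qed.

Lemma normc1_conj x : normc x = 1 -> x^* = x^-1.
Proof.
move=> x1; apply: (mulfI (normc1_neq0 _ x1)).
by rewrite mulc_conj x1 expr1n divff// normc1_neq0.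
Qed.

Lemma normc1_exprz x (n : int) : normc x = 1 -> normc (x ^ n) = 1.
Proof.
by move=> x1; case: n => n; rewrite ?NegzE -?exprnN ?exprnP ?Normc.normcV normcX x1 expr1n ?invr1.
Qed.

Lemma circle_measurable_exprz (n : int) : circle_measurable (fun z : R[i] => z ^ n).
Proof.
have H m : circle_measurable (fun z : R[i] => z ^+ m).
  elim: m => [|m IH]; first exact: (circle_measurable_cst 1).
  have := circle_measurableM _ _ circle_measurable_id IH.
  by apply: circle_measurable_eq => t; rewrite exprS.
case: n => n; first exact: H.
apply: circle_measurable_eq (circle_measurable_conj _ (H n.+1)) => t.
by rewrite NegzE -exprnN -exprVn normc1_conj ?normcX ?normc_expi ?expr1n// exprVn.
Qed.

Lemma circle_integrable_exprz (n : int) : circle_integrable (fun z : R[i] => z ^ n).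
Proof.
apply: (circle_integrable_bounded _ 1 (circle_measurable_exprz n)) => t.
by rewrite normc1_exprz ?normc_expi.
Qed.

Lemma derivable_exprz (n : int) w : w != 0 ->
  @derivable R[i] R[i]^o R[i]^o (fun z => z ^ n) w 1.
Proof.
have H m : @derivable R[i] R[i]^o R[i]^o (fun z => z ^+ m) w 1.
  elim: m => [|m IH]; first by apply: (@derivable_cst R[i] R[i]^o R[i]^o 1).
  have -> : (fun z : R[i] => z ^+ m.+1) = (fun z => z * z ^+ m).
    by apply/funext => z; rewrite exprS.
  exact: (@derivableM R[i] R[i]^o id _ w 1 (@derivable_id R[i] R[i]^o w 1) IH).
move=> w0; case: n => n; first exact: H.
have -> : (fun z : R[i] => z ^ Negz n) = (fun z => (z ^+ n.+1)^-1).
  by apply/funext => z; rewrite NegzE exprnN.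
exact: (@derivableV R[i] R[i]^o (fun z => z ^+ n.+1) w 1 (expf_neq0 _ w0) (H _)).
Qed.

Lemma real_complexXz (r : R) (n : int) : (r ^ n)%:C = r%:C ^ n.
Proof. exact: (fmorphXz (real_complex R)). Qed.

(** The mean of [w^n] over [|w| = r] is [r^n] times the mean over the unit circle, yet it does not
    depend on [r]; comparing two radii leaves 0 for [n != 0]. *)
Lemma circle_mean_exprz (n : int) :
  circle_mean (fun z : R[i] => z ^ n) = (n == 0)%:R.
Proof.
have [->|n0] := eqVneq n 0.
  by rewrite (circle_mean_eq _ (fun=> 1)) ?circle_mean_cst// => t; rewrite expr0z.
have C (r : R) : 0 < r -> circle_mean (fun z : R[i] => (r%:C * z) ^ n) =
    r%:C ^ n * circle_mean (fun z => z ^ n).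
  move=> r0; rewrite -circle_meanZ; last exact: circle_integrable_exprz.
  by apply: circle_mean_eq => t; rewrite expfzMl.
have r4 : 0 < (4^-1 : R) by rewrite invr_gt0.
have r2 : 0 < (2^-1 : R) by rewrite invr_gt0.
have /eqP : (4^-1)%:C ^ n * circle_mean (fun z : R[i] => z ^ n) =
    (2^-1)%:C ^ n * circle_mean (fun z : R[i] => z ^ n).
  apply: etrans (esym (C _ r4)) (etrans _ (C _ r2)).
  apply: (circle_mean_dilation_const (fun w => w ^ n)) => //; [lra|lra|].
  move=> w /andP[w0 _]; apply/derivable_cderivable_at/derivable_exprz.
  by apply/eqP => w0'; move: w0; rewrite w0' Normc.normc0 ltxx.
rewrite -subr_eq0 -mulrBl mulf_eq0 => /orP[|/eqP //].
rewrite subr_eq0 -!real_complexXz (inj_eq (@complexI R)).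
(* Writing [4^-1] as a square reduces the equality of powers to [2 * n = n]. *)
rewrite (_ : 4^-1 = 2^-1 ^+ 2 :> R); last by field.
have h1 : (2^-1 : R) != 1 by apply/eqP; lra.
rewrite exprnP exprz_exp (inj_eq (ieexprIz r2 h1)).
by rewrite -subr_eq0 mulrC -[X in _ - X]mulr1 -mulrBr mulf_eq0 (negbTE n0).
Qed.

(* On the circle this is the Fejer kernel at [x = zeta / w]. *)
Definition fejer_kernel (N : nat) x : R[i] :=
  N%:R^-1 * \sum_(j < N) \sum_(k < N) x ^ (j%:Z - k%:Z).

(** On the circle [x^-1] is the conjugate of [x], so the double sum is a geometric sum times its
    conjugate; this makes the kernel real and nonnegative. *)
Lemma fejer_kernelE N x : normc x = 1 ->
  fejer_kernel N x = (N%:R^-1 * normc (\sum_(j < N) x ^+ j) ^+ 2)%:C.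
Proof.
move=> x1; have x0 := normc1_neq0 _ x1.
rewrite real_complexM -mulc_conj rmorph_sum /= big_distrlr /=.
rewrite /fejer_kernel; congr (_ * _).
  by rewrite fmorphV rmorph_nat.
apply: eq_bigr => j _; apply: eq_bigr => k _.
by rewrite expfzDr// -exprnP rmorphXn /= normc1_conj// exprVn -exprnN.
Qed.

(** Multiplying by [x - 1] telescopes the geometric sum to [x^N - 1], of modulus at most 2. The
    factor [|x - 1|^2] thus gives decay in [N] uniformly on the circle. *)
Lemma normc_sub1_fejer_kernel N x : normc x = 1 -> (0 < N)%N ->
  normc (x - 1) ^+ 2 * complex.Re (fejer_kernel N x) <= 4 / N%:R.
Proof.
move=> x1 N0; rewrite fejer_kernelE//= mulrCA mulrC ler_wpM2r ?invr_ge0//.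
rewrite -exprMn -normcM -subrX1.
have : normc (x ^+ N - 1) <= 2.
  apply: le_trans (ler_normcB _ _) _.
  by rewrite normcX x1 expr1n Normc.normc1.
by have := normc_ge0 (x ^+ N - 1); nra.
Qed.

Lemma Re_fejer_kernel N x : normc x = 1 ->
  0 <= complex.Re (fejer_kernel N x) /\
  normc (fejer_kernel N x) = complex.Re (fejer_kernel N x).
Proof.
move=> x1; rewrite fejer_kernelE// normc_real.
have K0 : 0 <= N%:R^-1 * normc (\sum_(j < N) x ^+ j) ^+ 2.
  by rewrite mulr_ge0 ?sqr_ge0// invr_ge0.
by rewrite ger0_norm.
Qed.

(** A frequency [n] with [|n| < N] arises from [N - |n|] pairs [(j, k)], so this is the Cesaro mean
    with weights [1 - |n| / N]. *)
Definition fejer_mean (N : nat) f zeta : R[i] :=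
  N%:R^-1 * \sum_(j < N) \sum_(k < N) zeta ^ (j%:Z - k%:Z) * fourier_coef f (j%:Z - k%:Z).

Lemma circle_integrableM_exprz f (n : int) : circle_integrable f ->
  circle_integrable (fun z => f z * z ^ n).
Proof.
move=> fi; apply: (circle_integrableM_bounded _ _ 1 fi (circle_measurable_exprz n)).
by move=> t; rewrite normc1_exprz ?normc_expi.
Qed.

Lemma fejer_meanE N f zeta : circle_integrable f -> normc zeta = 1 ->
  fejer_mean N f zeta = circle_mean (fun w => f w * fejer_kernel N (zeta / w)) /\
  circle_integrable (fun w => f w * fejer_kernel N (zeta / w)).
Proof.
move=> fi z1; have z0 := normc1_neq0 _ z1.
pose F (j k : 'I_N) w := zeta ^ (j%:Z - k%:Z) * (f w * w ^ (- (j%:Z - k%:Z))).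
have Fi j k : circle_integrable (F j k).
  exact/circle_integrableZ/circle_integrableM_exprz.
pose FF z := N%:R^-1 * \sum_(j < N) \sum_(k < N) F j k z.
have FS t : FF (expi t) = f (expi t) * fejer_kernel N (zeta / expi t).
  rewrite /FF /fejer_kernel [RHS]mulrCA; congr (_ * _).
  rewrite mulr_sumr; apply: eq_bigr => j _; rewrite mulr_sumr; apply: eq_bigr => k _.
  by rewrite /F expfzMl exprz_inv mulrCA.
have Si j : circle_integrable (fun w => \sum_(k < N) F j k w).
  exact: circle_integrable_sum.
have SSi : circle_integrable (fun w => \sum_(j < N) \sum_(k < N) F j k w).
  exact: circle_integrable_sum.
split; last exact: (circle_integrable_eq FF (fun w => f w * fejer_kernel N (zeta / w)) FS (circle_integrableZ _ _ SSi)).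
rewrite -(circle_mean_eq FF (fun w => f w * fejer_kernel N (zeta / w)) FS) circle_meanZ// circle_mean_sum//.
rewrite /fejer_mean; congr (_ * _); apply: eq_bigr => j _.
rewrite circle_mean_sum//; apply: eq_bigr => k _.
by rewrite circle_meanZ//; exact: circle_integrableM_exprz.
Qed.

(** This mean is the Fejer mean of the constant 1, to which only the [N] diagonal pairs
    contribute. *)
Lemma circle_mean_fejer_kernel N zeta : (0 < N)%N -> normc zeta = 1 ->
  circle_mean (fun w => fejer_kernel N (zeta / w)) = 1.
Proof.
move=> N0 z1; have [E _] := fejer_meanE N _ zeta (circle_integrable_cst 1) z1.
rewrite (circle_mean_eq _ (fun w => 1 * fejer_kernel N (zeta / w))); last first.
  by move=> t; rewrite mul1r.
rewrite -E /fejer_mean (eq_bigr (fun=> 1)).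
  by rewrite sumr_const card_ord mulVf// pnatr_eq0 -lt0n.
move=> j _; rewrite (bigD1 j)//= big1.
  rewrite subrr expr0z mul1r addr0 /fourier_coef.
  by rewrite (circle_mean_eq _ (fun=> 1)) ?circle_mean_cst// => t; rewrite oppr0 mul1r expr0z.
move=> k kj; rewrite /fourier_coef.
rewrite (circle_mean_eq _ (fun z => z ^ (- (j%:Z - k%:Z)))); last by move=> t; rewrite mul1r.
rewrite circle_mean_exprz oppr_eq0 subr_eq0 eqz_nat.
by rewrite (_ : (j == k :> nat) = (j == k))// eq_sym (negbTE kj) mulr0.
Qed.

Section bounded.
Variables (f : R[i] -> R[i]) (M : R).
Hypotheses (fm : circle_measurable f) (fM : forall z, normc z = 1 -> normc (f z) <= M).

Let fi : circle_integrable f.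
Proof. by apply: (circle_integrable_bounded _ M fm) => t; rewrite fM ?normc_expi. Qed.

Let expi_div zeta t : normc zeta = 1 -> normc (zeta / expi t) = 1.
Proof. by move=> z1; rewrite normcM Normc.normcV z1 normc_expi invr1 mulr1. Qed.

Let kernel_integrable N zeta : normc zeta = 1 ->
  circle_integrable (fun w => fejer_kernel N (zeta / w)).
Proof.
move=> z1; have [_] := fejer_meanE N _ zeta (circle_integrable_cst 1) z1.
by apply: circle_integrable_eq => t; rewrite mul1r.
Qed.

Lemma normc_fejer_mean_le N zeta : (0 < N)%N -> normc zeta = 1 ->
  normc (fejer_mean N f zeta) <= 2 * M.
Proof.
move=> N0 z1; have [-> Ki] := fejer_meanE N f zeta fi z1.
have KI := kernel_integrable N _ z1.
apply: le_trans (normc_circle_mean_le _ _ Ki (circle_integrableZ M%:C _ KI) _) _.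
  move=> t; have [K0 KE] := Re_fejer_kernel N _ (expi_div _ t z1).
  by rewrite normcM Re_scale KE ler_wpM2r// fM// normc_expi.
by rewrite circle_meanZ// circle_mean_fejer_kernel// mulr1.
Qed.

(** The difference [|f w - f zeta|] is at most [e / 4 + C * |w - zeta|^2]. Integrated against the
    kernel, the first term keeps its size because the kernel has mean 1, and the second becomes at
    most [4 * C / N]. The index [n.+1] keeps the sum from being empty. *)
Lemma fejer_mean_cvg zeta : normc zeta = 1 ->
  (forall e : R, 0 < e -> exists2 d : R, 0 < d & forall w, normc w = 1 ->
     normc (w - zeta) < d -> normc (f w - f zeta) <= e) ->
  forall e : R, 0 < e -> exists N, forall n, (N <= n)%N ->
    normc (fejer_mean n.+1 f zeta - f zeta) <= e.
Proof.
move=> z1 fc e e0; have M0 : 0 <= M by exact: le_trans (normc_ge0 _) (fM _ z1).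
have [d d0 Hd] := fc (e / 4) ltac:(lra).
(* [C * d^2 = 2 * M] bounds the oscillation at distance at least [d]. *)
pose C := 2 * M / d ^+ 2; have C0 : 0 <= C by rewrite divr_ge0 ?sqr_ge0//; lra.
(* This makes the second term at most [e / 4]; the factor 2 of [normc_circle_mean_le] then turns
   [e / 4 + e / 4] into [e]. *)
exists (Num.truncn (16 * C / e)).+1 => n Nn.
have n0 : 0 < n.+1%:R :> R by rewrite ltr0n.
have Ce : C * (4 / n.+1%:R) <= e / 4.
  have : 16 * C / e <= n.+1%:R.
    apply/ltW/(lt_le_trans (truncnS_gt _)); rewrite ler_nat.
    exact: leq_trans Nn _.
  rewrite ler_pdivrMr// => H; rewrite mulrA ler_pdivrMr//.
  by move: (n.+1%:R) H => k H; lra.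
have [E Ki] := fejer_meanE n.+1 f zeta fi z1.
have KI := kernel_integrable n.+1 _ z1.
have -> : fejer_mean n.+1 f zeta - f zeta =
    circle_mean (fun w => (f w - f zeta) * fejer_kernel n.+1 (zeta / w)).
  rewrite E -[f zeta in LHS]mulr1 -(circle_mean_fejer_kernel n.+1 zeta)//.
  rewrite -mulNr -circle_meanZ// -circle_meanD//; last exact: circle_integrableZ.
  by apply: circle_mean_eq => t; rewrite mulrBl mulNr.
have Di : circle_integrable (fun w => (f w - f zeta) * fejer_kernel n.+1 (zeta / w)).
  apply: circle_integrable_eq (circle_integrableD _ _ Ki
    (circle_integrableZ (- f zeta) _ KI)) => t.
  by rewrite mulrBl mulNr.
apply: le_trans (normc_circle_mean_le _ _ Di (circle_integrableD _ _
  (circle_integrableZ (e / 4)%:C _ KI) (circle_integrable_cst (C * (4 / n.+1%:R))%:C)) _) _.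
  move=> t; have x1 := expi_div zeta t z1.
  have [K0 KE] := Re_fejer_kernel n.+1 _ x1.
  rewrite normcM ReD Re_scale KE /=.
  have fd : normc (f (expi t) - f zeta) <= e / 4 + C * normc (zeta / expi t - 1) ^+ 2.
    have -> : normc (zeta / expi t - 1) = normc (expi t - zeta).
      rewrite -(mulfV (expi_neq0 t)) -mulrBl normcM Normc.normcV normc_expi invr1 mulr1.
      by rewrite -normc_opp opprB.
    have [wz|wz] := ltP (normc (expi t - zeta)) d.
      by apply: le_trans (Hd _ (normc_expi t) wz) _; rewrite lerDl mulr_ge0 ?sqr_ge0.
    apply: le_trans (_ : C * d ^+ 2 <= _).
      rewrite /C divfK ?expf_neq0 ?gt_eqF//; apply: le_trans (ler_normcB _ _) _.
      by have := fM _ (normc_expi t); have := fM _ z1; lra.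
    have : C * d ^+ 2 <= C * normc (expi t - zeta) ^+ 2.
      by rewrite ler_wpM2l// lerXn2r ?nnegrE ?normc_ge0//; exact: ltW.
    by lra.
  have xK := normc_sub1_fejer_kernel n.+1 _ x1 isT.
  apply: le_trans (ler_wpM2r K0 fd) _; rewrite mulrDl lerD2l -mulrA ler_wpM2l//.
rewrite circle_meanD; [|exact: circle_integrableZ|exact: circle_integrable_cst].
rewrite circle_meanZ// circle_mean_fejer_kernel// circle_mean_cst mulr1 ReD /=.
by move: (C * _) Ce => k Ce; lra.
Qed.

End bounded.

(** The Fejer means of [f] involve nonnegative frequencies only, each of which has mean 0 against
    [g]. They tend to [f] pointwise by continuity and are bounded by [2 * M], so a multiple of a
    bound for [|g|] dominates the products. *)
Lemma circle_mean_analytic_mul f g (M : R) : circle_measurable f ->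
  (forall z, normc z = 1 -> normc (f z) <= M) ->
  (forall zeta, normc zeta = 1 -> forall e : R, 0 < e ->
    exists2 d : R, 0 < d & forall w, normc w = 1 ->
     normc (w - zeta) < d -> normc (f w - f zeta) <= e) ->
  (forall n : int, n < 0 -> fourier_coef f n = 0) -> circle_integrable g ->
  (forall n : nat, circle_mean (fun z => g z * z ^+ n) = 0) ->
  circle_mean (fun z => f z * g z) = 0.
Proof.
move=> fm fM fc f0 gi g0; have [h hi gh] := circle_integrable_bound _ gi.
have Fi n : circle_integrable (fun z => fejer_mean n.+1 f z * g z) /\
    circle_mean (fun z => fejer_mean n.+1 f z * g z) = 0.
  pose F (j k : 'I_n.+1) z : R[i] := fourier_coef f (j%:Z - k%:Z) * (g z * z ^ (j%:Z - k%:Z)).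
  have Fi j k : circle_integrable (F j k).
    exact/circle_integrableZ/circle_integrableM_exprz.
  have Si j : circle_integrable (fun w => \sum_(k < n.+1) F j k w).
    exact: circle_integrable_sum.
  have SSi : circle_integrable (fun w => \sum_(j < n.+1) \sum_(k < n.+1) F j k w).
    exact: circle_integrable_sum.
  pose FF z := n.+1%:R^-1 * \sum_(j < n.+1) \sum_(k < n.+1) F j k z.
  have FS t : FF (expi t) = fejer_mean n.+1 f (expi t) * g (expi t).
    rewrite /FF /fejer_mean -mulrA; congr (_ * _).
    rewrite mulr_suml; apply: eq_bigr => j _; rewrite mulr_suml; apply: eq_bigr => k _.
    by rewrite /F; ring.
  split; first exact: (circle_integrable_eq FF (fun z => fejer_mean n.+1 f z * g z) FS (circle_integrableZ _ _ SSi)).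
  rewrite -(circle_mean_eq FF (fun z => fejer_mean n.+1 f z * g z) FS) circle_meanZ// circle_mean_sum// big1 ?mulr0// => j _.
  rewrite circle_mean_sum// big1// => k _.
  rewrite circle_meanZ; last exact: circle_integrableM_exprz.
  have [jk|jk] := leP 0 (j%:Z - k%:Z); last by rewrite f0// mul0r.
  by case: (j%:Z - k%:Z) jk => m // _; rewrite g0 mulr0.
apply: (circle_mean_limit (fun n z => fejer_mean n.+1 f z * g z) _ (fun t => 2 * M * h t)).
- by move=> n; have [] := circle_integrable_measurable _ (Fi n).1.
- exact: (circle_measurableM _ _ fm (circle_integrable_measurable _ gi)).
- have := integrableZl measurable_angles (2 * M) hi; apply: eq_integrable => // t _.
- move=> n t; rewrite normcM ler_pM ?normc_ge0//.
  exact: (normc_fejer_mean_le _ _ fm fM n.+1 _ isT (normc_expi t)).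
- apply: ae_all => t _ e e0; have G0 := normc_ge0 (g (expi t)).
  have e' : 0 < e / (1 + normc (g (expi t))) by rewrite divr_gt0//; lra.
  have [N HN] := fejer_mean_cvg f M fm fM _ (normc_expi t) (fc _ (normc_expi t)) _ e'.
  exists N => n /HN; rewrite -mulrBl normcM ler_pdivlMr; last lra.
  by have := normc_ge0 (fejer_mean n.+1 f (expi t) - f (expi t)); lra.
- by move=> n; exact: (Fi n).2.
Qed.

End fejer_means.

(** * Bounded analytic functions and their radial limits *)

Section bounded_analytic.
Context {R : realType}.
Implicit Types (g h : R[i] -> R[i]) (z w zeta : R[i]).
Notation mu := (@lebesgue_measure R).
Notation normc := (@Normc.normc R).

Local Hint Resolve measurable_angles : core.

Definition dilation (u : R[i] -> R[i]) (r : R) : R[i] -> R[i] := fun z => u (r%:C * z).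

Lemma disc0 : disc (0 : R[i]).
Proof. by rewrite /disc /mkset Normc.normc0 ltr01. Qed.

Lemma disc_dilation (r : R) z : 0 <= r < 1 -> normc z = 1 -> disc (r%:C * z).
Proof. by move=> r01 z1; rewrite /disc /= normcM z1 normc_real ger0_norm; lra. Qed.

Variables (u : R[i] -> R[i]) (M : R).
Hypotheses (ua : analytic_on_disc u) (uM : forall z, disc z -> normc (u z) <= M).

Lemma analytic_ccontinuous z : disc z -> ccontinuous_at u z.
Proof. by move=> /ua /derivable_cderivable_at /cderivable_continuous. Qed.

Lemma circle_measurable_dilation (r : R) : 0 <= r < 1 -> circle_measurable (dilation u r).
Proof.
move=> r01.
have H (k : R[i]) : continuous (fun t => complex.Re (k * u (r%:C * expi t))).
  move=> t; apply: (ccontinuous_Re_path (fun z => k * u z) (fun t => r%:C * expi t) t 2).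
    move=> y; cbv beta; rewrite -mulrBr normcM normc_real ger0_norm; last lra.
    have := normc_expi_sub t y; have := normc_ge0 (expi y - expi t); nra.
  exact/ccontinuousZ/analytic_ccontinuous/disc_dilation/normc_expi.
split.
  apply: measurable_funTS; apply: continuous_measurable_fun.
  have := H 1; rewrite (_ : (fun _ => _) = (fun t => complex.Re (dilation u r (expi t))))//.
  by apply/funext => t; rewrite mul1r.
apply: measurable_funTS; apply: continuous_measurable_fun.
have := H (- 'i); rewrite (_ : (fun _ => _) = (fun t => complex.Im (dilation u r (expi t))))//.
by apply/funext => t; rewrite /dilation; case: (u _) => a b /=; ring.
Qed.

Lemma normc_dilation_le (r : R) z : 0 <= r < 1 -> normc z = 1 -> normc (dilation u r z) <= M.
Proof. by move=> r01 z1; exact/uM/disc_dilation. Qed.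

Lemma circle_integrable_dilation (r : R) : 0 <= r < 1 -> circle_integrable (dilation u r).
Proof.
move=> r01; apply: (circle_integrable_bounded _ M (circle_measurable_dilation _ r01)) => t.
by rewrite normc_dilation_le ?normc_expi.
Qed.

Lemma fourier_coef_dilation (n : int) (r s : R) : 0 < r -> r <= s -> s < 1 ->
  r%:C ^ (- n) * fourier_coef (dilation u r) n = s%:C ^ (- n) * fourier_coef (dilation u s) n.
Proof.
move=> r0 rs s1.
have C (x : R) : 0 < x < 1 -> circle_mean (fun z => u (x%:C * z) * (x%:C * z) ^ (- n)) =
    x%:C ^ (- n) * fourier_coef (dilation u x) n.
  move=> x01; rewrite -circle_meanZ; last first.
    by apply/circle_integrableM_exprz/circle_integrable_dilation; lra.
  by apply: circle_mean_eq => t; rewrite expfzMl mulrCA.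
have r01 : 0 < r < 1 by lra.
have s01 : 0 < s < 1 by lra.
apply: etrans (esym (C r r01)) (etrans _ (C s s01)).
apply: (circle_mean_dilation_const (fun w => u w * w ^ (- n))) => // w /andP[w0 w1].
have w0' : w != 0.
  by apply/eqP => w0'; move: w0; rewrite w0' Normc.normc0 ltxx.
apply: derivable_cderivable_at.
exact: (@derivableM R[i] R[i]^o u (fun w => w ^ (- n)) w 1 (ua _ w1)
  (derivable_exprz _ _ w0')).
Qed.

(** The shift to [n.+2] keeps both [1 / (n + 2)] and [1 - 1 / (n + 2)] inside [(0, 1)]: the first
    sequence of radii shrinks to the origin, the second, [radius], grows to the unit circle. *)
Lemma harmonic_cvg (e : R) : 0 < e -> exists N, forall n, (N <= n)%N -> n.+2%:R^-1 <= e.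
Proof.
move=> e0; exists (Num.truncn e^-1).+1 => n Nn.
have n0 : 0 < n.+2%:R :> R by rewrite ltr0n.
rewrite invf_ple ?posrE//; apply/ltW/(lt_le_trans (truncnS_gt _)).
rewrite ler_nat; apply: leq_trans Nn _; exact/leqW/leqW.
Qed.

Let rad0 (n : nat) : 0 < n.+2%:R^-1 :> R.
Proof. by rewrite invr_gt0 ltr0n. Qed.

Let rad1 (n : nat) : n.+2%:R^-1 <= 2^-1 :> R.
Proof. by rewrite lef_pV2 ?posrE ?ltr0n// ler_nat. Qed.

Lemma dilation_cvg0 zeta (e : R) : normc zeta = 1 -> 0 < e ->
  exists N, forall n, (N <= n)%N -> normc (dilation u n.+2%:R^-1 zeta - u 0) <= e.
Proof.
move=> z1 e0; have [d d0 Hd] := analytic_ccontinuous _ disc0 _ e0.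
have d20 : 0 < d / 2 by lra.
have [N HN] := harmonic_cvg _ d20; exists N => n /HN nd; apply: Hd.
rewrite subr0 normcM z1 mulr1 normc_real ger0_norm ?ltW//.
by apply: le_lt_trans nd _; lra.
Qed.

Lemma bound_ge0 : 0 <= M.
Proof.
exact: le_trans (normc_ge0 _) (uM _ disc0).
Qed.

Lemma fourier_coef_dilation_const (n : int) (r s : R) : 0 < r < 1 -> 0 < s < 1 ->
  r%:C ^ (- n) * fourier_coef (dilation u r) n = s%:C ^ (- n) * fourier_coef (dilation u s) n.
Proof.
move=> r01 s01; have [rs|/ltW sr] := leP r s; last symmetry;
  by apply: fourier_coef_dilation; lra.
Qed.

Lemma circle_integrable_fourier (n : int) (r : R) : 0 <= r < 1 ->
  circle_integrable (fun z => dilation u r z * z ^ n).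
Proof. by move=> r01; exact/circle_integrableM_exprz/circle_integrable_dilation. Qed.

Let rad01 (n : nat) : 0 < (n.+2%:R^-1 : R) < 1.
Proof. by have := rad0 n; have := rad1 n; move: (_^-1) => x; lra. Qed.

(** For [n = -m] the mean of [u(w) w^m] over [|w| = r] is at most of order [r^m], while it is the
    same for all [r]. *)
Lemma fourier_coef_dilation_lt0 (n : int) (r : R) : 0 < r < 1 -> n < 0 ->
  fourier_coef (dilation u r) n = 0.
Proof.
case: n => // n r01 _; have -> : Negz n = - n.+1%:Z by rewrite NegzE.
have rn0 : r%:C ^ (- - n.+1%:Z) != 0 :> R[i].
  rewrite opprK expf_neq0// -(rmorph0 (real_complex R)) (inj_eq (@complexI R)).
  by apply/eqP; lra.
have M0 := bound_ge0.
apply: (mulfI rn0); rewrite mulr0; apply/esym.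
pose x k : R := k.+2%:R^-1.
pose F k z : R[i] := (x k)%:C ^+ n.+1 * (dilation u (x k) z * z ^ (- - n.+1%:Z)).
have x01 k : 0 < x k < 1 by exact: rad01.
have Fi k : circle_integrable (F k).
  by apply/circle_integrableZ/circle_integrable_fourier; have := x01 k; lra.
have FM k t : normc (F k (expi t)) <= x k * M.
  rewrite /F !normcM normc1_exprz ?normc_expi// mulr1 normcX normc_real.
  have xk := x01 k; rewrite ger0_norm; last lra.
  rewrite ler_pM ?normc_ge0 ?exprn_ge0//; [lra| |].
    by rewrite exprS ler_piMr ?exprn_ile1//; lra.
  by apply: normc_dilation_le; [lra|exact: normc_expi].
rewrite -(circle_mean_cst 0).
apply: (circle_mean_limit F _ (cst M)).
- by move=> k; have [] := circle_integrable_measurable _ (Fi k).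
- exact: circle_measurable_cst.
- exact: integrable_cst_angles.
- move=> k t; apply: le_trans (FM k t) _; have := x01 k; rewrite /=; nra.
- apply: ae_all => t _ e e0.
  have e' : 0 < e / (M + 1) by rewrite divr_gt0//; lra.
  have [N HN] := harmonic_cvg _ e'; exists N => k /HN xk.
  rewrite subr0; apply: le_trans (FM k t) _.
  move: xk; rewrite -/(x k) ler_pdivlMr; last lra.
  by have := x01 k; nra.
- move=> k; rewrite (fourier_coef_dilation_const _ r (x k))// -circle_meanZ//.
  by apply: circle_integrable_fourier; have := x01 k; lra.
Qed.

Lemma fourier_coef_dilation_0 (r : R) : 0 < r < 1 -> fourier_coef (dilation u r) 0 = u 0.
Proof.
move=> r01; pose x k : R := k.+2%:R^-1.
have x01 k : 0 < x k < 1 by exact: rad01.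
have E k : fourier_coef (dilation u (x k)) 0 = fourier_coef (dilation u r) 0.
  have := fourier_coef_dilation_const 0 (x k) r (x01 k) r01.
  by rewrite oppr0 !expr0z !mul1r.
rewrite -[RHS]circle_mean_cst; apply/esym.
apply: (circle_mean_limit (fun k z => dilation u (x k) z * z ^ (- 0)) _ (cst M)).
- move=> k; have x01' : 0 <= x k < 1 by have := x01 k; lra.
  exact: (circle_integrable_measurable _ (circle_integrable_fourier _ _ x01')).
- exact: circle_measurable_cst.
- exact: integrable_cst_angles.
- move=> k t; rewrite oppr0 expr0z mulr1; apply: normc_dilation_le; last exact: normc_expi.
  by have := x01 k; lra.
- apply: ae_all => t _ e e0; have [N HN] := dilation_cvg0 _ _ (normc_expi t) e0.
  by exists N => k /HN; rewrite oppr0 expr0z mulr1.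
- by move=> k; exact: (E k).
Qed.

Lemma dilation_continuous (r : R) zeta (e : R) : 0 <= r < 1 -> normc zeta = 1 -> 0 < e ->
  exists2 d : R, 0 < d & forall w, normc w = 1 -> normc (w - zeta) < d ->
    normc (dilation u r w - dilation u r zeta) <= e.
Proof.
move=> r01 z1 e0; have [d d0 Hd] := analytic_ccontinuous _ (disc_dilation r _ r01 z1) _ e0.
exists d => // w w1 wz; apply: Hd; rewrite -mulrBr normcM normc_real ger0_norm; last lra.
by have := normc_ge0 (w - zeta); nra.
Qed.

(** At radius [|z|] every Fejer mean at the point [z / |z|] reduces to the coefficient of index 0,
    which is [u 0]; continuity of the dilation makes these means converge to [u z]. *)
Lemma analytic_const_of_fourier :
  (forall (n : nat) (r : R), 0 < r < 1 -> fourier_coef (dilation u r) n.+1 = 0) ->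
  forall z, disc z -> u z = u 0.
Proof.
move=> fu0 z zd; have [->|z0] := eqVneq z 0; first by [].
have nz0 : 0 < normc z.
  by rewrite lt_def normc_ge0 andbT; apply: contra z0 => /eqP/Normc.eq0_normc ->.
set r := normc z in nz0; have r01 : 0 < r < 1 by rewrite nz0.
have r01' : 0 <= r < 1 by lra.
pose zeta := r%:C^-1 * z.
have rc0 : r%:C != 0 :> R[i].
  by rewrite -(rmorph0 (real_complex R)) (inj_eq (@complexI R)) gt_eqF.
have z1 : normc zeta = 1.
  by rewrite normcM Normc.normcV normc_real gtr0_norm// mulVf// gt_eqF.
have zE : dilation u r zeta = u z by rewrite /dilation mulrA mulfV// mul1r.
have FE n : fejer_mean n.+1 (dilation u r) zeta = u 0.
  rewrite /fejer_mean (eq_bigr (fun=> u 0)).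
    rewrite sumr_const card_ord -[u 0 *+ _]mulr_natl mulrA mulVf ?mul1r// pnatr_eq0.
  move=> j _; rewrite (bigD1 j)//= big1.
    by rewrite subrr expr0z mul1r addr0 fourier_coef_dilation_0.
  move=> k kj; have [jk|jk|jk] := ltgtP (j%:Z) (k%:Z).
  - by rewrite fourier_coef_dilation_lt0 ?mulr0// subr_lt0.
  - have : 0 < j%:Z - k%:Z by rewrite subr_gt0.
    by case: (j%:Z - k%:Z) => [[|m]|m] // _; rewrite fu0 ?mulr0.
  - by move: kj; case: jk => jk; rewrite -val_eqE /= jk eqxx.
have dM w : normc w = 1 -> normc (dilation u r w) <= M by exact: normc_dilation_le.
have H := fejer_mean_cvg _ _ (circle_measurable_dilation _ r01') dM _ z1
  (fun e e0 => dilation_continuous _ _ e r01' z1 e0).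
apply/eqP; rewrite -zE eq_sym -subr_eq0; apply/eqP/Normc.eq0_normc.
apply/eqP; rewrite eq_le normc_ge0 andbT leNgt; apply/negP => e0.
have e20 : 0 < normc (u 0 - dilation u r zeta) / 2 by lra.
have [N /(_ N (leqnn N))] := H _ e20; rewrite FE; lra.
Qed.

End bounded_analytic.

(** * The radial limit and its Fourier coefficients *)

Section boundary_values.
Context {R : realType}.
Implicit Types (g h : R[i] -> R[i]) (z w zeta : R[i]).
Notation mu := (@lebesgue_measure R).
Notation normc := (@Normc.normc R).

Local Hint Resolve measurable_angles : core.

Lemma normr_limn_sup_le (v : nat -> R) (M : R) :
  (forall n, `|v n| <= M) -> `|limn_sup v| <= M.
Proof.
move=> vM; have vb : bounded_fun v.
  by exists M; split; [exact: num_real|move=> x Mx n _; exact: le_trans (vM n) (ltW Mx)].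
have vM' n : - M <= v n <= M by rewrite -ler_norml.
have sM n : - M <= sups v n <= M.
  rewrite /sups; apply/andP; split.
    have /andP[vn _] := vM' n; apply: le_trans vn _; apply: ub_le_sup; last by exists n => /=.
    by exists M => _ [k _ <-]; have /andP[] := vM' k.
  apply: ge_sup; first by exists (v n), n => /=.
  by move=> _ [k _ <-]; have /andP[] := vM' k.
rewrite limn_supE// ler_norml; apply/andP; split.
  apply: lb_le_inf; first by exists (sups v 0%N), 0%N.
  by move=> _ [k _ <-]; have /andP[] := sM k.
have /andP[_ s0] := sM 0%N; apply: le_trans s0; apply: ge_inf; last by exists 0%N.
by exists (- M) => _ [k _ <-]; have /andP[] := sM k.
Qed.

Definition radius (n : nat) : R := 1 - n.+2%:R^-1.

Lemma radius_itv n : 2^-1 <= radius n < 1.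
Proof.
have h0 : 0 < n.+2%:R^-1 :> R by rewrite invr_gt0 ltr0n.
have h1 : n.+2%:R^-1 <= 2^-1 :> R by rewrite lef_pV2 ?posrE ?ltr0n// ler_nat.
by rewrite /radius; move: (n.+2%:R^-1) h0 h1 => x h0 h1; lra.
Qed.

Lemma radial_filter_seq (u : R[i] -> R[i]) z : cvg (radial_filter u z) ->
  forall e : R, 0 < e -> exists N, forall n, (N <= n)%N ->
    normc (dilation u (radius n) z - boundary u z) <= e.
Proof.
move=> ucv e e0; have e0' : 0 < e%:C :> R[i] by rewrite ltcR.
have {}ucv : (u (r%:C * z) : R[i]^o) @[r --> (1 : R)^'-] --> (boundary u z : R[i]^o) := ucv.
move/cvgrPdist_le/(_ _ e0') : ucv => /nbhs_ballP[d d0 Hd].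
have d20 : 0 < d / 2 by rewrite divr_gt0.
have [N HN] := harmonic_cvg _ d20; exists N => n /HN nd.
have rn := radius_itv n.
have := Hd (radius n); rewrite /ball /= => /(_ _ _)/wrap[||].
- rewrite /radius opprB addrC subrK ger0_norm ?invr_ge0//.
  by apply: le_lt_trans nd _; move: d0 => /= d0; lra.
- lra.
by rewrite norm_normc lecR -normc_opp opprB.
Qed.

Variables (u : R[i] -> R[i]) (M : R).
Hypotheses (ua : analytic_on_disc u) (uM : forall z, disc z -> normc (u z) <= M).
Hypothesis ub : ae_circle (fun z => cvg (radial_filter u z) /\ normc (boundary u z) = 1).

(** A representative of [boundary u], whose values are uncontrolled where the radial limit fails to
    exist. Upper limits over a sequence of radii are measurable in the angle and bounded at every
    point, and they agree with [boundary u] wherever the limit exists. *)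
Definition radial_limit z : R[i] :=
  limn_sup (fun n => complex.Re (dilation u (radius n) z)) +i*
  limn_sup (fun n => complex.Im (dilation u (radius n) z)).

Let radius01 n : 0 <= radius n < 1.
Proof. by have := radius_itv n; lra. Qed.

Let dM n z : normc z = 1 -> normc (dilation u (radius n) z) <= M.
Proof. by apply: normc_dilation_le uM _ _ _; exact: radius01. Qed.

Lemma circle_measurable_radial_limit : circle_measurable radial_limit.
Proof.
split; rewrite /radial_limit /=.
  apply: (measurable_fun_limn_sup (h := fun n t => complex.Re (dilation u (radius n) (expi t)))).
  - move=> t _; exists M => _ [n _ <-]; have := normr_Re_le (dilation u (radius n) (expi t)).
    by have := dM n _ (normc_expi t); have := ler_norm (complex.Re (dilation u (radius n) (expi t))); lra.
  - move=> t _; exists (- M) => _ [n _ <-]; have := normr_Re_le (dilation u (radius n) (expi t)).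
    by have := dM n _ (normc_expi t); rewrite ler_norml => ? /andP[]; lra.
  - by move=> n; have [] := circle_measurable_dilation _ ua _ (radius01 n).
apply: (measurable_fun_limn_sup (h := fun n t => complex.Im (dilation u (radius n) (expi t)))).
- move=> t _; exists M => _ [n _ <-]; have := normr_Im_le (dilation u (radius n) (expi t)).
  by have := dM n _ (normc_expi t); have := ler_norm (complex.Im (dilation u (radius n) (expi t))); lra.
- move=> t _; exists (- M) => _ [n _ <-]; have := normr_Im_le (dilation u (radius n) (expi t)).
  by have := dM n _ (normc_expi t); rewrite ler_norml => ? /andP[]; lra.
- by move=> n; have [] := circle_measurable_dilation _ ua _ (radius01 n).
Qed.

Lemma radial_limitE z : cvg (radial_filter u z) -> radial_limit z = boundary u z.
Proof.
move=> /radial_filter_seq ucv; apply: complex_ext => /=.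
  apply: (cvg_limn_inf_sup _).2; apply/cvgrPdist_le => e /ucv[N HN].
  near=> n; rewrite distrC -ReN -ReD; apply: le_trans (normr_Re_le _) _.
  by apply: HN; near: n; exact: nbhs_infty_ge.
apply: (cvg_limn_inf_sup _).2; apply/cvgrPdist_le => e /ucv[N HN].
near=> n; rewrite distrC -ImN -ImD; apply: le_trans (normr_Im_le _) _.
by apply: HN; near: n; exact: nbhs_infty_ge.
Unshelve. all: by end_near. Qed.

Lemma normc_radial_limit_le z : normc z = 1 -> normc (radial_limit z) <= 2 * M.
Proof.
move=> z1; apply: le_trans (normc_le_ReIm _) _ => /=.
have H1 : `|limn_sup (fun n => complex.Re (dilation u (radius n) z))| <= M.
  by apply: normr_limn_sup_le => n; apply: le_trans (normr_Re_le _) _; exact: dM.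
have H2 : `|limn_sup (fun n => complex.Im (dilation u (radius n) z))| <= M.
  by apply: normr_limn_sup_le => n; apply: le_trans (normr_Im_le _) _; exact: dM.
by lra.
Qed.

Lemma radial_limit_boundary_ae : ae_circle (fun z => radial_limit z = boundary u z).
Proof. by apply: ae_mono ub => t + Dt => /(_ Dt)[/radial_limitE]. Qed.

Lemma normc_radial_limit_ae : ae_circle (fun z => normc (radial_limit z) = 1).
Proof. by apply: ae_mono ub => t + Dt => /(_ Dt)[/radial_limitE ->]. Qed.

(** The vanishing correction [e_ k] makes the means exactly constant in [k], as [circle_mean_limit]
    requires, also when the means over the dilations merely converge. *)
Lemma circle_mean_radial_limit g (e_ : nat -> R[i]) (B : R) (c : R[i]) :
  circle_integrable g -> (forall k, normc (e_ k) <= B) ->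
  (forall e : R, 0 < e -> exists N, forall n, (N <= n)%N -> normc (e_ n) <= e) ->
  (forall k, circle_mean (fun z => dilation u (radius k) z * g z) + e_ k = c) ->
  circle_mean (fun z => radial_limit z * g z) = c.
Proof.
move=> gi eB e0 Ec; have [h hi gh] := circle_integrable_bound _ gi.
have Fm k : circle_measurable (fun z => dilation u (radius k) z * g z).
  apply: circle_measurableM; last exact: circle_integrable_measurable.
  exact: circle_measurable_dilation ua _ (radius01 k).
have Fi k : circle_integrable (fun z => dilation u (radius k) z * g z).
  apply: circle_integrable_eq (circle_integrableM_bounded _ _ M gi
    (circle_measurable_dilation _ ua _ (radius01 k)) _).
    by move=> t; rewrite mulrC.
  by move=> t; rewrite dM ?normc_expi.
apply: (circle_mean_limit (fun k z => dilation u (radius k) z * g z + e_ k) _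
  (fun t => M * h t + B)).
- by move=> k; apply: circle_measurableD => //; exact: circle_measurable_cst.
- apply: circle_measurableM; last exact: circle_integrable_measurable.
  exact: circle_measurable_radial_limit.
- have := integrableD measurable_angles (integrableZl measurable_angles M hi)
    (integrable_cst_angles B).
  by apply: eq_integrable => // t _.
- move=> k t; apply: le_trans (ler_normcD _ _) _; rewrite lerD// normcM.
  by rewrite ler_pM ?normc_ge0// dM// normc_expi.
- apply: ae_mono ub => t + Dt => /(_ Dt)[ucv _] e ep.
  have G0 := normc_ge0 (g (expi t)).
  have e' : 0 < e / 2 / (1 + normc (g (expi t))) by rewrite !divr_gt0//; lra.
  have [N1 H1] := radial_filter_seq _ _ ucv _ e'.
  have [N2 H2] := e0 (e / 2) ltac:(lra).
  exists (maxn N1 N2) => n; rewrite geq_max => /andP[/H1 n1 /H2 n2].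
  rewrite radial_limitE// addrAC -mulrBl; apply: le_trans (ler_normcD _ _) _.
  rewrite normcM; move: n1; rewrite ler_pdivlMr; last lra.
  by have := normc_ge0 (dilation u (radius n) (expi t) - boundary u (expi t)); lra.
- move=> k; rewrite circle_meanD ?circle_mean_cst//.
  exact: circle_integrable_cst.
Qed.

Lemma bernoulli_ge (x : R) n : 0 <= x <= 1 -> 1 - x ^+ n <= n%:R * (1 - x).
Proof.
move=> x01; elim: n => [|n IH]; first by rewrite expr0 subrr mul0r.
rewrite exprSr -natr1 mulrDl mul1r.
have xn0 : 0 <= x ^+ n by rewrite exprn_ge0; lra.
have xn1 : x ^+ n <= 1 by rewrite exprn_ile1; lra.
by nra.
Qed.

Lemma fourier_coef_radial_limit (n : nat) (r : R) : 0 < r < 1 ->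
  fourier_coef (dilation u r) n = r%:C ^+ n * fourier_coef radial_limit n.
Proof.
move=> r01; set c := fourier_coef _ _.
have rc0 : r%:C ^+ n != 0 :> R[i].
  by rewrite expf_neq0// -(rmorph0 (real_complex R)) (inj_eq (@complexI R)); apply/eqP; lra.
(* [r^(-n)] times the coefficient is the same at every radius, so [c'] is the candidate for radius
   1. *)
pose c' := c / r%:C ^+ n.
have cE k : fourier_coef (dilation u (radius k)) n = (radius k)%:C ^+ n * c'.
  have k01 : 0 < radius k < 1 by have := radius_itv k; lra.
  have kc0 : (radius k)%:C ^+ n != 0 :> R[i].
    by rewrite expf_neq0// -(rmorph0 (real_complex R)) (inj_eq (@complexI R)); apply/eqP; lra.
  have := fourier_coef_dilation_const _ _ ua uM n _ _ k01 r01.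
  rewrite -!exprnN => /(canRL (mulKf _)).
  by rewrite invr_eq0 kc0 invrK => ->//; rewrite /c' [c / _]mulrC.
suff -> : fourier_coef radial_limit n = c' by rewrite /c' mulrC divfK.
have z0 : circle_integrable (fun z : R[i] => z ^ (- n%:Z)) by exact: circle_integrable_exprz.
(* The coefficient at radius [radius k] misses [c'] by this correction, which tends to 0 by
   Bernoulli's inequality. *)
apply: (circle_mean_radial_limit _ (fun k => (1 - radius k ^+ n)%:C * c') (normc c') _ z0).
- move=> k; have rk := radius_itv k.
  rewrite normcM normc_real ger0_norm ?subr_ge0 ?exprn_ile1//; try lra.
  rewrite ler_piMl ?normc_ge0// lerBlDr lerDl exprn_ge0//; lra.
- move=> e e0; have C0 := normc_ge0 c'; have n0 : 0 <= n%:R :> R by exact: ler0n.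
  have nC0 : 0 <= n%:R * normc c' by exact: mulr_ge0.
  have e' : 0 < e / (n%:R * normc c' + 1) by rewrite divr_gt0//; lra.
  have [N HN] := harmonic_cvg _ e'; exists N => k /HN kN.
  have rk := radius_itv k; have B := bernoulli_ge (radius k) n.
  rewrite normcM normc_real ger0_norm ?subr_ge0 ?exprn_ile1//; try lra.
  apply: le_trans (_ : n%:R * (1 - radius k) * normc c' <= _).
    by rewrite ler_wpM2r// B; lra.
  rewrite {1}/radius opprB addrC subrK; move: kN; rewrite ler_pdivlMr; last lra.
  have : 0 <= k.+2%:R^-1 :> R by rewrite invr_ge0.
  by move: (k.+2%:R^-1) => x; nra.
- move=> k; rewrite -/(fourier_coef _ _) cE (real_complexB 1 (radius k ^+ n)) mulrBl mul1r.
  by rewrite (rmorphXn (real_complex R)) /=; ring.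
Qed.

Lemma fourier_coef_radial_limit_le0 (n : int) : n <= 0 ->
  fourier_coef radial_limit n = if n == 0 then u 0 else 0.
Proof.
move=> n0; have z0 : circle_integrable (fun z : R[i] => z ^ (- n)) by exact: circle_integrable_exprz.
apply: (circle_mean_radial_limit _ (fun=> 0) 0 _ z0).
- by move=> _; rewrite Normc.normc0.
- by move=> e e0; exists 0%N => k _; rewrite Normc.normc0 ltW.
move=> k; have k01 : 0 < radius k < 1 by have := radius_itv k; lra.
rewrite addr0 -/(fourier_coef _ _); case: eqVneq => [->|n0'].
  exact: fourier_coef_dilation_0 ua uM _ k01.
apply: fourier_coef_dilation_lt0 ua uM _ _ k01 _.
by rewrite lt_neqAle n0' n0.
Qed.

(** The vanishing negative coefficients of [h] say that [h z^(n+1)] has mean 0 against every [z^m]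
    with [m >= 0]. The dilations are continuous on the circle, so [circle_mean_analytic_mul] applies
    to them, and the limit of the radii carries the result to the boundary. *)
Lemma circle_mean_radial_limit_H2 h (n : nat) : H2 h -> circle_integrable h ->
  circle_mean (fun z => radial_limit z * (h z * z ^+ n.+1)) = 0.
Proof.
move=> [_ h0] hi; have gi := circle_integrableM_exprz h n.+1 hi.
apply: (circle_mean_radial_limit _ (fun=> 0) 0 _ gi).
- by move=> _; rewrite Normc.normc0.
- by move=> e e0; exists 0%N => k _; rewrite Normc.normc0 ltW.
move=> k; have k01 : 0 < radius k < 1 by have := radius_itv k; lra.
rewrite addr0; apply: (circle_mean_analytic_mul (dilation u (radius k)) (fun z => h z * z ^+ n.+1) M).
- exact: circle_measurable_dilation ua _ (radius01 k).
- exact: dM.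
- by move=> zeta z1 e e0; exact: dilation_continuous ua _ _ _ (radius01 k) z1 e0.
- by move=> m m0; exact: fourier_coef_dilation_lt0 ua uM _ _ k01 m0.
- exact: gi.
- move=> m; rewrite -(h0 (- (n.+1 + m)%N%:Z)); last by rewrite oppr_lt0.
  by apply: circle_mean_eq => t; rewrite opprK -mulrA -exprD.
Qed.

End boundary_values.

(** * Hardy and model spaces *)

Section hardy_space.
Context {R : realType}.
Implicit Types f g h : R[i] -> R[i].
Notation normc := (@Normc.normc R).

Lemma L2_circle_integrable f : L2 f -> circle_integrable f.
Proof.
move=> fL; apply: circle_integrable_eq (L2_dot_integrable f _ fL (L2_cst 1)) => t.
by rewrite conjC1 mulr1.
Qed.

Lemma dotL2_1r f : dotL2 f (fun=> 1) = circle_mean f.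
Proof. by apply: circle_mean_eq => t; rewrite conjC1 mulr1. Qed.

Lemma dotL2_1l f : L2 f -> dotL2 (fun=> 1) f = (circle_mean f)^*.
Proof. by move=> fL; rewrite (dotL2C f)// ?dotL2_1r//; exact: L2_cst. Qed.

Lemma L2_shift f : L2 f -> L2 (shift f).
Proof.
apply: (L2_mul_bounded _ f 1 circle_measurable_id) => t.
by rewrite normc_expi.
Qed.

Lemma dotL2_shift f g : dotL2 (shift f) (shift g) = dotL2 f g.
Proof.
apply: circle_mean_eq => t; rewrite /shift rmorphM mulrACA mulc_conj normc_expi.
by rewrite expr1n mul1r.
Qed.

(** On the circle [z^*] is [1 / z], and the mean of an element of [H2] is its value at 0, so this is
    [(f - f(0)) / z]. *)
Definition backward_shift f : R[i] -> R[i] := fun z => z^* * (f z - circle_mean f).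

Lemma shift_backward_shift f t :
  shift (backward_shift f) (expi t) = f (expi t) - circle_mean f.
Proof. by rewrite /shift /backward_shift mulrA mulc_conj normc_expi expr1n mul1r. Qed.

Lemma L2_backward_shift f : L2 f -> L2 (backward_shift f).
Proof.
move=> fL; apply: (L2_mul_bounded _ _ 1 (circle_measurable_conj _ circle_measurable_id)).
  by move=> t; rewrite normc_conj normc_expi.
exact: L2B _ _ fL (L2_cst _).
Qed.

Lemma H2P f : H2 f <-> L2 f /\ forall n : nat, circle_mean (fun z => f z * z ^+ n.+1) = 0.
Proof.
split=> -[fL f0]; split => // n.
  by have := f0 (- n.+1%:Z) isT; rewrite /fourier_coef opprK.
case: n => // n _; rewrite -[RHS](f0 n); apply: circle_mean_eq => t.
by rewrite NegzE opprK.
Qed.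

Lemma H2_cst (c : R[i]) : H2 (fun=> c).
Proof.
apply/H2P; split=> [|n]; first exact: L2_cst.
by rewrite circle_meanZ ?(circle_mean_exprz n.+1) ?mulr0//; exact: (circle_integrable_exprz n.+1).
Qed.

Lemma H2D f g : H2 f -> H2 g -> H2 (fun z => f z + g z).
Proof.
move=> /H2P[fL f0] /H2P[gL g0]; apply/H2P; split=> [|n]; first exact: L2D.
have fi := circle_integrableM_exprz f n.+1 (L2_circle_integrable _ fL).
have gi := circle_integrableM_exprz g n.+1 (L2_circle_integrable _ gL).
rewrite -[RHS](addr0 0) -[X in _ = X + _](f0 n) -[X in _ = _ + X](g0 n) -circle_meanD//.
by apply: circle_mean_eq => t; rewrite mulrDl.
Qed.

Lemma H2Z (c : R[i]) f : H2 f -> H2 (fun z => c * f z).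
Proof.
move=> /H2P[fL f0]; apply/H2P; split=> [|n]; first exact: L2Z.
have fi := circle_integrableM_exprz f n.+1 (L2_circle_integrable _ fL).
rewrite -[RHS](mulr0 c) -(f0 n) -circle_meanZ//.
by apply: circle_mean_eq => t; rewrite mulrA.
Qed.

Lemma H2B f g : H2 f -> H2 g -> H2 (fun z => f z - g z).
Proof.
move=> fH gH; have := H2D f _ fH (H2Z (-1) _ gH).
by rewrite (_ : (fun z => _) = (fun z => f z - g z))//; apply/funext => z; rewrite mulN1r.
Qed.

Lemma H2_shift f : H2 f -> H2 (shift f).
Proof.
move=> /H2P[fL f0]; apply/H2P; split=> [|n]; first exact: L2_shift.
rewrite -[RHS](f0 n.+1); apply: circle_mean_eq => t.
by rewrite /shift (exprS _ n.+1); ring.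
Qed.

Lemma circle_mean_shift f : H2 f -> circle_mean (shift f) = 0.
Proof.
by move=> /H2P[_ f0]; rewrite -[RHS](f0 0%N); apply: circle_mean_eq => t; rewrite /shift mulrC.
Qed.

Lemma circle_mean_shift_backward f : L2 f -> circle_mean (shift (backward_shift f)) = 0.
Proof.
move=> fL; transitivity (circle_mean (fun z => f z - circle_mean f)).
  by apply: circle_mean_eq => t; exact: shift_backward_shift.
rewrite -dotL2_1r dotL2Bl//; try exact: L2_cst.
by rewrite !dotL2_1r circle_mean_cst subrr.
Qed.

Lemma H2_backward_shift f : H2 f -> H2 (backward_shift f).
Proof.
move=> fH; have /H2P[fL f0] := fH; apply/H2P; split=> [|n]; first exact: L2_backward_shift.
have E t : backward_shift f (expi t) * expi t ^+ n.+1 =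
    (f (expi t) - circle_mean f) * expi t ^+ n.
  by rewrite exprS -shift_backward_shift /shift; ring.
transitivity (circle_mean (fun z => (f z - circle_mean f) * z ^+ n)).
  exact: circle_mean_eq.
case: n {E} => [|n].
  rewrite -[RHS](circle_mean_shift_backward f fL); apply: circle_mean_eq => t.
  by rewrite expr0 mulr1 shift_backward_shift.
by have /H2P[_] := H2B _ _ fH (H2_cst (circle_mean f)); exact.
Qed.

Lemma normL2_backward_shift f : L2 f ->
  normL2 (backward_shift f) ^+ 2 = normL2 f ^+ 2 - normc (circle_mean f) ^+ 2.
Proof.
move=> fL; have n1 : normL2 (fun=> 1 : R[i]) = 1.
  by rewrite /normL2 dotL2_1r circle_mean_cst sqrtr1.
have := normL2_sub_proj f (fun=> 1) fL (L2_cst 1) n1; rewrite dotL2_1r => <-.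
rewrite /normL2 -dotL2_shift; congr (Num.sqrt (complex.Re _) ^+ 2).
by apply: dotL2_eq => t; rewrite shift_backward_shift mulr1.
Qed.

(** For [f] in [H2] the function [z f] has mean 0, so subtracting from [g] its mean does not change
    the inner product. The identity serves twice: for the adjoint, and to rewrite the functional
    sending [f] to the inner product of [z f] with the boundary function. *)
Lemma dotL2_shift_backward f g : H2 f -> L2 g ->
  dotL2 (shift f) g = dotL2 f (backward_shift g).
Proof.
move=> fH gL; have [fL _] := fH; have sfL := L2_shift _ fL.
rewrite -[RHS]dotL2_shift.
transitivity (dotL2 (shift f) (fun z => g z - circle_mean g)); last first.
  by apply: dotL2_eq => // t; rewrite shift_backward_shift.
rewrite dotL2Br//; last exact: L2_cst.
have -> : dotL2 (shift f) (fun=> circle_mean g) = (circle_mean g)^* * circle_mean (shift f).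
  transitivity (dotL2 (shift f) (fun z => circle_mean g * 1)).
    by apply: dotL2_eq => // t; rewrite mulr1.
  by rewrite (dotL2Zr (circle_mean g) (fun=> 1))// ?dotL2_1r//; exact: L2_cst.
by rewrite circle_mean_shift// mulr0 subr0.
Qed.

End hardy_space.

(** * Minimum modulus of an operator with rank-one defect *)

Section min_modulus.
Context {R : realType}.
Implicit Types f g h : R[i] -> R[i].
Notation normc := (@Normc.normc R).

(* Two vectors of [K] inducing the same functional on [K] have the same norm,
   so the representatives chosen by [xget] may be replaced by explicit ones. *)
Lemma normL2_eq_of_dot (K : set (R[i] -> R[i])) g1 g2 : L2 g1 -> L2 g2 -> K g1 -> K g2 ->
  (forall h, K h -> dotL2 h g1 = dotL2 h g2) -> normL2 g1 = normL2 g2.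
Proof.
move=> g1L g2L K1 K2 E.
rewrite /normL2 E// (dotL2C g2 g1)// ReJ E//.
Qed.

(** By Cauchy-Schwarz [|T f|^2] is at least [1 - |k|^2 = a^2] on unit vectors, with equality at
    [k / |k|]. The bound [a < 1] makes [k] nonzero; this is where nonconstancy of the inner function
    enters. *)
Lemma min_modulus_attained (K : set (R[i] -> R[i])) (T : (R[i] -> R[i]) -> R[i] -> R[i])
    k (a : R) : 0 <= a -> a < 1 ->
  (forall f, K f -> L2 f) -> (forall (c : R[i]) f, K f -> K (fun z => c * f z)) ->
  K k -> normL2 k ^+ 2 = 1 - a ^+ 2 ->
  (forall f, K f -> normL2 (T f) ^+ 2 = normL2 f ^+ 2 - normc (dotL2 f k) ^+ 2) ->
  min_modulus K T = a /\ attains_min_modulus K T.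
Proof.
move=> a0 a1 KL KZ Kk kn TE; have kL := KL _ Kk.
have lb f : K f -> normL2 f = 1 -> a <= normL2 (T f).
  move=> Kf f1; rewrite -ler_sqr ?nnegrE ?normL2_ge0// TE// f1.
  by have := normc_dotL2_le f k (KL _ Kf) kL; rewrite f1 kn; lra.
have k0 : 0 < normL2 k.
  rewrite lt_def normL2_ge0 andbT; apply/eqP => k0; move: kn; rewrite k0 expr0n /=.
  by nra.
pose f0 z : R[i] := (normL2 k)^-1%:C * k z.
have Kf0 : K f0 by exact: KZ.
have f01 : normL2 f0 = 1.
  apply/eqP; rewrite -(@eqrXn2 _ 2) ?normL2_ge0//; apply/eqP/(@complexI R).
  rewrite -dotL2_self; last exact: KL.
  rewrite dotL2Zl ?dotL2Zr//; last exact: L2Z.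
  rewrite dotL2_self// mulrA mulc_conj normc_real -real_complexM.
  by rewrite ger0_norm ?invr_ge0 ?normL2_ge0// -exprMn mulVf// gt_eqF.
have Tf0 : normL2 (T f0) = a.
  apply/eqP; rewrite -(@eqrXn2 _ 2) ?normL2_ge0//; apply/eqP.
  rewrite TE// f01 dotL2Zl// dotL2_self// -real_complexM normc_real expr2 mulKf ?gt_eqF//.
  by rewrite ger0_norm ?normL2_ge0// kn; ring.
have mE : min_modulus K T = a.
  apply/eqP; rewrite eq_le; apply/andP; split.
    by apply: ge_inf; [exists a => _ [f [Kf f1] <-]; exact: lb|exists f0].
  apply: lb_le_inf; first by exists a, f0.
  by move=> _ [f [Kf f1] <-]; exact: lb.
by split => //; exists f0; rewrite mE.
Qed.

End min_modulus.

(** * The compressed shift and its adjoint *)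

Section model_space_operators.
Context {R : realType}.
Implicit Types f g h : R[i] -> R[i].
Notation normc := (@Normc.normc R).

Variables (u : R[i] -> R[i]) (M : R).
Hypotheses (ua : analytic_on_disc u) (uM : forall z, disc z -> normc (u z) <= M).
Hypothesis ub : ae_circle (fun z => cvg (radial_filter u z) /\ normc (boundary u z) = 1).

Let phi := radial_limit u.
Let K := model_space u.

Lemma circle_mean_phi_shift h : H2 h -> circle_mean (fun z => phi z * shift h z) = 0.
Proof.
move=> hH; have hi := L2_circle_integrable _ hH.1.
rewrite -[RHS](circle_mean_radial_limit_H2 u M ua uM ub h 0 hH hi).
by apply: circle_mean_eq => t; rewrite /shift expr1 (mulrC (expi t)).
Qed.

Lemma L2_phi_mul f : L2 f -> L2 (fun z => phi z * f z).
Proof.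
apply: (L2_mul_bounded phi f (2 * M) (circle_measurable_radial_limit _ _ ua uM)) => t.
by apply: normc_radial_limit_le uM _ _; exact: normc_expi.
Qed.

Lemma L2_phi : L2 phi.
Proof.
have := L2_phi_mul (fun=> 1) (L2_cst 1).
by rewrite (_ : (fun z => _) = phi)//; apply/funext => z; rewrite mulr1.
Qed.

Lemma H2_phi : H2 phi.
Proof.
split=> [|n n0]; first exact: L2_phi.
rewrite (fourier_coef_radial_limit_le0 u M ua uM ub) ?ltW//.
by rewrite (negbTE (ltr0_neq0 n0)).
Qed.

Lemma circle_mean_phi : circle_mean phi = u 0.
Proof.
have := fourier_coef_radial_limit_le0 u M ua uM ub 0 (lexx 0); rewrite eqxx => <-.
by apply: circle_mean_eq => t; rewrite oppr0 expr0z mulr1.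
Qed.

Lemma dotL2_phi_mul f g : L2 f -> L2 g ->
  dotL2 (fun z => phi z * f z) (fun z => phi z * g z) = dotL2 f g.
Proof.
move=> fL gL; have pfL := L2_phi_mul _ fL; have pgL := L2_phi_mul _ gL.
apply: circle_mean_ae.
- exact: circle_integrable_measurable (L2_dot_integrable _ _ pfL pgL).
- exact: circle_integrable_measurable (L2_dot_integrable _ _ fL gL).
- apply: ae_mono (normc_radial_limit_ae u ub) => t + Dt => /(_ Dt) p1.
  by rewrite rmorphM mulrACA mulc_conj p1 expr1n mul1r.
Qed.

Lemma normL2_phi : normL2 phi = 1.
Proof.
have E : dotL2 phi phi = 1.
  transitivity (dotL2 (fun z => phi z * 1) (fun z => phi z * 1)).
    by apply: dotL2_eq => t; rewrite mulr1.
  rewrite (dotL2_phi_mul (fun=> 1) (fun=> 1)); try exact: L2_cst.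
  by rewrite dotL2_1r circle_mean_cst.
by rewrite /normL2 E sqrtr1.
Qed.

Lemma dotL2_phi_shift h : H2 h -> dotL2 (fun=> 1) (fun z => phi z * shift h z) = 0.
Proof.
move=> hH; have [hL _] := hH.
by rewrite dotL2_1l ?circle_mean_phi_shift ?conjC0//; exact/L2_phi_mul/L2_shift.
Qed.

(** [h] is its mean plus a multiple of [z], so questions about [phi h] split into one about [phi]
    and one about [phi z H2], where means vanish. *)
Lemma phi_mul_decomp h t : phi (expi t) * h (expi t) =
  circle_mean h * phi (expi t) + phi (expi t) * shift (backward_shift h) (expi t).
Proof. by rewrite shift_backward_shift; ring. Qed.

Lemma circle_mean_phi_mul h : H2 h -> circle_mean (fun z => phi z * h z) = u 0 * circle_mean h.
Proof.
move=> hH; have [hL _] := hH; have bH := H2_backward_shift _ hH.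
transitivity (circle_mean (fun z => circle_mean h * phi z + phi z * shift (backward_shift h) z)).
  by apply: circle_mean_eq => t; exact: phi_mul_decomp.
have pi := L2_circle_integrable _ L2_phi.
rewrite circle_meanD; first last.
- by apply: L2_circle_integrable; apply: L2_phi_mul; apply: L2_shift; case: bH.
- exact: circle_integrableZ.
by rewrite circle_meanZ// circle_mean_phi circle_mean_phi_shift// addr0 mulrC.
Qed.

Lemma model_spaceP f : K f <-> H2 f /\ forall h, H2 h -> dotL2 f (fun z => phi z * h z) = 0.
Proof.
split=> -[fH f0]; split => //; have [fL _] := fH.
  move=> h hH; have [hL _] := hH; apply: f0; split; first exact: L2_phi_mul.
  exists h => //; apply: ae_mono (radial_limit_boundary_ae u ub) => t + Dt => /(_ Dt).
  by rewrite /phi => ->.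
move=> g [gL [h hH gh]]; have [hL _] := hH.
have pL := L2_phi_mul _ hL.
rewrite (dotL2C g f)// (dotL2_ae g (fun z => phi z * h z) f)//.
  by rewrite -(dotL2C _ f)// f0.
apply: ae_mono (ae_and _ _ gh (radial_limit_boundary_ae u ub)) => t [+ +] Dt.
by move=> /(_ Dt) -> /(_ Dt) <-.
Qed.

Lemma model_space_L2 f : K f -> L2 f.
Proof. by move=> [[]]. Qed.

Lemma model_spaceZ (c : R[i]) f : K f -> K (fun z => c * f z).
Proof.
move=> /model_spaceP[fH f0]; apply/model_spaceP; split; first exact: H2Z.
have [fL _] := fH; move=> h hH; have [hL _] := hH.
by rewrite dotL2Zl ?f0 ?mulr0//; exact: L2_phi_mul.
Qed.

Lemma model_space_dot_phi f : K f -> dotL2 f phi = 0.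
Proof.
move=> /model_spaceP[_ f0]; rewrite -[RHS](f0 _ (H2_cst 1)).
by apply: dotL2_eq => // t; rewrite mulr1.
Qed.

Lemma dotL2_shift_phi_shift f h : K f -> H2 h ->
  dotL2 (shift f) (fun z => phi z * shift h z) = 0.
Proof.
move=> /model_spaceP[_ f0] hH; rewrite -[RHS](f0 _ hH) -[RHS]dotL2_shift.
by apply: dotL2_eq => // t; rewrite /shift; ring.
Qed.

(** [z f] is already orthogonal to [phi z H2], and [phi H2] is that space plus the line of [phi].
    Removing the component along the unit vector [phi] therefore lands in the model space. *)
Lemma compressed_shift_model f : K f ->
  K (fun z => shift f z - dotL2 (shift f) phi * phi z).
Proof.
move=> Kf; have /model_spaceP[fH f0] := Kf; have [fL _] := fH.
have sL := L2_shift _ fL; have pL := L2_phi.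
set c := dotL2 _ _; apply/model_spaceP; split.
  by apply: H2B; [exact: H2_shift|exact/H2Z/H2_phi].
move=> h hH; have [hL _] := hH; have bH := H2_backward_shift _ hH; have [bL _] := bH.
have phL := L2_phi_mul _ hL.
have E1 : dotL2 (shift f) (fun z => phi z * h z) = (circle_mean h)^* * c.
  transitivity (dotL2 (shift f) (fun z => circle_mean h * phi z + phi z * shift (backward_shift h) z)).
    by apply: dotL2_eq => // t; exact: phi_mul_decomp.
  rewrite dotL2Dr//; [|exact: L2Z|exact/L2_phi_mul/L2_shift].
  by rewrite dotL2Zr// dotL2_shift_phi_shift// addr0.
have E2 : dotL2 phi (fun z => phi z * h z) = (circle_mean h)^*.
  transitivity (dotL2 (fun z => phi z * 1) (fun z => phi z * h z)).
    by apply: dotL2_eq => // t; rewrite mulr1.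
  by rewrite (dotL2_phi_mul (fun=> 1) h (L2_cst 1) hL) dotL2_1l.
rewrite dotL2Bl//; last exact: L2Z.
by rewrite E1 dotL2Zl// E2 mulrC subrr.
Qed.

(** Multiplying both arguments by [z] turns the test functions [phi h] into [phi z h], to which both
    [f] and the constants are orthogonal. *)
Lemma backward_shift_model f : K f -> K (backward_shift f).
Proof.
move=> Kf; have /model_spaceP[fH f0] := Kf; have [fL _] := fH; have bL := L2_backward_shift _ fL.
apply/model_spaceP; split; first exact: H2_backward_shift.
move=> h hH; have [hL _] := hH; have shH := H2_shift _ hH; have [shL _] := shH.
have pL := L2_phi_mul _ shL.
rewrite -dotL2_shift; transitivity (dotL2 (fun z => f z - circle_mean f * 1) (fun z => phi z * shift h z)).
  by apply: dotL2_eq => t; rewrite ?shift_backward_shift ?mulr1// /shift; ring.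
rewrite dotL2Bl//; last exact/L2Z/L2_cst.
rewrite f0// dotL2Zl//; last exact: L2_cst.
by rewrite dotL2_phi_shift// mulr0 subrr.
Qed.

(** [xget] satisfies its predicate once some function does; the explicit difference is such a
    witness, since [phi] is orthogonal to the model space. *)
Lemma compressed_shiftP f : K f -> K (compressed_shift u f) /\
  forall h, K h -> dotL2 (shift f \- compressed_shift u f) h = 0.
Proof.
move=> Kf; have fL := model_space_L2 _ Kf; have sL := L2_shift _ fL; have pL := L2_phi.
apply: (@xgetPex _ _ [set g | K g /\ forall h, K h -> dotL2 (shift f \- g) h = 0]).
exists (fun z => shift f z - dotL2 (shift f) phi * phi z); split.
  exact: compressed_shift_model.
move=> h Kh; have hL := model_space_L2 _ Kh.
transitivity (dotL2 (fun z => dotL2 (shift f) phi * phi z) h).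
  by apply: dotL2_eq => // t /=; rewrite opprB addrC subrK.
by rewrite dotL2Zl// (dotL2C h phi)// (model_space_dot_phi h Kh) conjC0 mulr0.
Qed.

Lemma compressed_shift_dot f h : K f -> K h ->
  dotL2 (compressed_shift u f) h = dotL2 (shift f) h.
Proof.
move=> Kf Kh; have [KS S0] := compressed_shiftP _ Kf.
have := S0 h Kh; rewrite dotL2Bl.
- by move/eqP; rewrite subr_eq0 => /eqP.
- exact/L2_shift/model_space_L2.
- exact: model_space_L2.
- exact: model_space_L2.
Qed.

Lemma normL2_compressed_shift f : K f ->
  normL2 (compressed_shift u f) ^+ 2 = normL2 f ^+ 2 - normc (dotL2 (shift f) phi) ^+ 2.
Proof.
move=> Kf; have [KS S0] := compressed_shiftP _ Kf.
have fL := model_space_L2 _ Kf; have sL := L2_shift _ fL; have pL := L2_phi.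
have KE := compressed_shift_model _ Kf.
rewrite (normL2_eq_of_dot K _ _ (model_space_L2 _ KS) (model_space_L2 _ KE) KS KE).
  rewrite (normL2_sub_proj (shift f) phi sL pL normL2_phi).
  by rewrite {1}/normL2 dotL2_shift.
move=> h Kh; have hL := model_space_L2 _ Kh.
have KEL := model_space_L2 _ KE; have KSL := model_space_L2 _ KS.
rewrite (dotL2C _ h KSL hL) compressed_shift_dot// (dotL2C _ h KEL hL); congr (_^*).
rewrite dotL2Bl//; last exact: L2Z.
by rewrite dotL2Zl// (dotL2C h phi)// (model_space_dot_phi h Kh) conjC0 mulr0 subr0.
Qed.

Lemma compressed_shift_adj_backward f h : K f -> K h ->
  dotL2 (compressed_shift u h) f = dotL2 h (backward_shift f).
Proof.
move=> Kf Kh; rewrite compressed_shift_dot//; apply: dotL2_shift_backward.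
  by case: Kh.
exact: model_space_L2.
Qed.

Lemma normL2_compressed_shift_adj f : K f ->
  normL2 (compressed_shift_adj u f) ^+ 2 = normL2 f ^+ 2 - normc (circle_mean f) ^+ 2.
Proof.
move=> Kf; have fL := model_space_L2 _ Kf; have Kb := backward_shift_model _ Kf.
rewrite -normL2_backward_shift//.
have [KA A0] : K (compressed_shift_adj u f) /\ forall h, K h ->
    dotL2 (compressed_shift u h) f = dotL2 h (compressed_shift_adj u f).
  apply: (@xgetPex _ _ [set g | K g /\ forall h, K h ->
    dotL2 (compressed_shift u h) f = dotL2 h g]).
  by exists (backward_shift f); split => // h Kh; exact: compressed_shift_adj_backward.
rewrite (normL2_eq_of_dot K _ _ (model_space_L2 _ KA) (model_space_L2 _ Kb) KA Kb)//.
by move=> h Kh; rewrite -A0// compressed_shift_adj_backward.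
Qed.

(** Against [phi z h] the function [phi] pairs as 1 does with [z h], because [|phi| = 1] almost
    everywhere, and the mean of [z h] is 0; the constant subtracted from [phi] pairs to 0 by
    [dotL2_phi_shift]. *)
Lemma backward_shift_phi_model : K (backward_shift phi).
Proof.
have pL := L2_phi; apply/model_spaceP; split; first exact/H2_backward_shift/H2_phi.
move=> h hH; have [hL _] := hH; have shH := H2_shift _ hH; have [shL _] := shH.
have psL := L2_phi_mul _ shL.
rewrite -dotL2_shift.
transitivity (dotL2 (fun z => phi z * 1 - circle_mean phi * 1) (fun z => phi z * shift h z)).
  by apply: dotL2_eq => t; rewrite ?shift_backward_shift ?mulr1// /shift; ring.
have p1L := L2_phi_mul _ (L2_cst 1); have c1 := L2_cst (1 : R[i]).
rewrite dotL2Bl//; last exact: L2Z.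
rewrite dotL2_phi_mul// dotL2Zl// dotL2_phi_shift// dotL2_1l// circle_mean_shift//.
by rewrite conjC0 mulr0 subrr.
Qed.

(** The projection of 1 onto the model space, that is, its reproducing kernel at the origin. The
    coefficient is [(u 0)^*]; written as an inner product it matches [normL2_sub_proj]. *)
Let kernel0 : R[i] -> R[i] := fun z => 1 - dotL2 (fun=> 1) phi * phi z.

Lemma dotL2_1_phi : dotL2 (fun=> 1) phi = (u 0)^*.
Proof. by rewrite dotL2_1l ?circle_mean_phi//; exact: L2_phi. Qed.

Lemma reproducing_kernel0_model : K kernel0.
Proof.
have pL := L2_phi; have c1 := L2_cst (1 : R[i]).
apply/model_spaceP; split.
  by apply: H2B; [exact: H2_cst|exact/H2Z/H2_phi].
move=> h hH; have [hL _] := hH; have phL := L2_phi_mul _ hL.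
rewrite /kernel0 dotL2Bl//; last exact: L2Z.
rewrite dotL2Zl// (dotL2_1l (fun z => phi z * h z))// circle_mean_phi_mul//.
transitivity ((u 0 * circle_mean h)^* - dotL2 (fun=> 1) phi *
  dotL2 (fun z => phi z * 1) (fun z => phi z * h z)).
  by congr (_ - _ * _); apply: dotL2_eq => // t; rewrite mulr1.
by rewrite dotL2_phi_mul// dotL2_1_phi dotL2_1l// rmorphM subrr.
Qed.

Lemma normL2_1 : normL2 (fun=> 1 : R[i]) = 1.
Proof. by rewrite /normL2 dotL2_1r circle_mean_cst sqrtr1. Qed.

Lemma normL2_kernel0 : normL2 kernel0 ^+ 2 = 1 - normc (u 0) ^+ 2.
Proof.
rewrite (normL2_sub_proj (fun=> 1) phi (L2_cst 1) L2_phi normL2_phi) normL2_1 expr1n.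
by rewrite dotL2_1_phi normc_conj.
Qed.

Lemma normc_u0_le1 : normc (u 0) <= 1.
Proof.
have := sqr_ge0 (normL2 kernel0); rewrite normL2_kernel0 subr_ge0.
by rewrite -[X in _ <= X -> _](expr1n _ 2) ler_sqr ?nnegrE ?normc_ge0.
Qed.

Lemma normc_u0_lt1 : nonconstant u -> normc (u 0) < 1.
Proof.
move=> unc; rewrite lt_neqAle normc_u0_le1 andbT; apply/eqP => u01; apply: unc.
exists (u 0); apply: (analytic_const_of_fourier _ _ ua uM) => n r r01.
have pL := L2_phi; have bL := L2_backward_shift _ pL.
have b0 : normL2 (backward_shift phi) ^+ 2 = 0.
  by rewrite normL2_backward_shift// normL2_phi circle_mean_phi u01 subrr.
have zL : L2 (fun z : R[i] => z ^+ n).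
  apply: (L2_bounded _ 1 (circle_measurable_exprz n)) => t.
  by rewrite normcX normc_expi expr1n.
rewrite (fourier_coef_radial_limit u M ua uM ub n.+1 r r01).
suff -> : fourier_coef phi n.+1 = 0 by rewrite mulr0.
(* The coefficient of [phi] of index [n + 1] is the inner product of [backward_shift phi] with
   [z^n]. That function is known to be 0 only in norm, so Cauchy-Schwarz carries the vanishing
   over. *)
have : normc (dotL2 (backward_shift phi) (fun z => z ^+ n)) ^+ 2 <= 0.
  by apply: le_trans (normc_dotL2_le _ _ bL zL) _; rewrite b0 mul0r.
rewrite le_eqVlt ltNge sqr_ge0 orbF sqrf_eq0 => /eqP/Normc.eq0_normc bz.
have zi : circle_integrable (fun z : R[i] => z ^ (- n.+1%:Z)) := circle_integrable_exprz _.
have pzi := circle_integrableM_exprz _ (- n.+1%:Z) (L2_circle_integrable _ pL).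
transitivity (dotL2 (backward_shift phi) (fun z => z ^+ n)); last exact: bz.
(* [backward_shift phi] contains the mean of [phi], whose contribution at index [n + 1] is 0; it is
   inserted to make the two integrands agree. *)
rewrite -[LHS]subr0.
have <- : circle_mean (fun z : R[i] => circle_mean phi * z ^ (- n.+1%:Z)) = 0.
  by rewrite circle_meanZ// circle_mean_exprz oppr_eq0 /= mulr0.
rewrite -mulN1r -circle_meanZ; last exact: circle_integrableZ.
rewrite -circle_meanD//; last exact/circle_integrableZ/circle_integrableZ.
apply: circle_mean_eq => t.
rewrite /backward_shift normc1_conj ?normc_expi//.
rewrite rmorphXn /= normc1_conj ?normc_expi// -exprnN exprS invfM exprVn; ring.
Qed.

Lemma compressed_shift_min_modulus : nonconstant u ->
  min_modulus K (compressed_shift u) = normc (u 0) /\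
  attains_min_modulus K (compressed_shift u).
Proof.
move=> unc; apply: (min_modulus_attained K _ (backward_shift phi) _ (normc_ge0 _)
  (normc_u0_lt1 unc) model_space_L2 model_spaceZ backward_shift_phi_model).
  by rewrite normL2_backward_shift ?normL2_phi ?circle_mean_phi ?expr1n//; exact: L2_phi.
(* Moving the shift across turns the inner product of [z f] with [phi] into that of [f] with
   [backward_shift phi]. *)
move=> f Kf; rewrite normL2_compressed_shift// dotL2_shift_backward//; last exact: L2_phi.
by case: Kf.
Qed.

Lemma compressed_shift_adj_min_modulus : nonconstant u ->
  min_modulus K (compressed_shift_adj u) = normc (u 0) /\
  attains_min_modulus K (compressed_shift_adj u).
Proof.
move=> unc; apply: (min_modulus_attained K _ kernel0 _ (normc_ge0 _)
  (normc_u0_lt1 unc) model_space_L2 model_spaceZ reproducing_kernel0_model).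
  exact: normL2_kernel0.
move=> f Kf; rewrite normL2_compressed_shift_adj//; congr (_ - normc _ ^+ 2).
have fL := model_space_L2 _ Kf; have pL := L2_phi; have c1 := L2_cst (1 : R[i]).
(* [f] is orthogonal to [phi], so only the constant 1 in [kernel0] contributes, and it gives the
   mean of [f]. *)
rewrite /kernel0 dotL2Br//; last exact: L2Z.
by rewrite dotL2Zr// (model_space_dot_phi f Kf) mulr0 subr0 dotL2_1r.
Qed.

End model_space_operators.

Theorem theorem3p5 (R : realType) (u : R[i] -> R[i])
    (u_inner : inner_function u) (u_nonconstant : nonconstant u) :
  let K := model_space u in
  let Su := compressed_shift u in
  let Su_adj := compressed_shift_adj u in
  [/\ min_modulus K Su = Normc.normc (u 0),
      Normc.normc (u 0) = min_modulus K Su_adj,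
      attains_min_modulus K Su &
      attains_min_modulus K Su_adj].
Proof.
have [ua [M uM] ub] := u_inner.
have [mS aS] := compressed_shift_min_modulus u M ua uM ub u_nonconstant.
by have [mA aA] := compressed_shift_adj_min_modulus u M ua uM ub u_nonconstant.
Qed.
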